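(* Assume the setting of the following: $k\ge1$; $\mathcal{S}_w\subset\mathbb{R}^d$, $\mathcal{S}_{v_\ell}\subset\mathbb{R}^{n_\ell}$ compact convex; $\mathcal{S}_v=\mathcal{S}_{v_1}\times\dots\times\mathcal{S}_{v_k}$; $\psi:\mathcal{S}_w\times\mathcal{S}_v\to\mathbb{R}$ continuous and convex-concave; $\alpha_\ell(w)=A_\ell w+a_\ell$, $\beta_\ell(u)=B_\ell u+b_\ell$ affine ($A_\ell\in\mathbb{R}^{d\times d}$, $a_\ell\in\mathbb{R}^d$, $B_\ell\in\mathbb{R}^{n_\ell\times n_\ell}$, $b_\ell\in\mathbb{R}^{n_\ell}$); $G_\ell\in\mathbb{R}^{n_\ell\times d}$, $g_\ell\in\mathbb{R}^d$, $h_\ell\in\mathbb{R}^{n_\ell}$ mutually independent with i.i.d. $\mathcal{N}(0,1)$ entries. For a compact set $T\subset\mathcal{S}_w$ define $$\Phi_T(G):=\min_{w\in T}\max_{v\in\mathcal{S}_v}\sum_{\ell=1}^k\beta_\ell(v_\ell)^TG_\ell\alpha_\ell(w)+\psi(w,v),$$ $$\phi_T(g,h):=\min_{w\in T}\max_{v\in\mathcal{S}_v}\sum_{\ell=1}^k\Big[\|\beta_\ell(v_\ell)\|_2g_\ell^T\alpha_\ell(w)+\|\alpha_\ell(w)\|_2h_\ell^T\beta_\ell(v_\ell)\Big]+\psi(w,v),$$ and write $\Phi=\Phi_{\mathcal{S}_w}$, $\phi=\phi_{\mathcal{S}_w}$. Let $\mathcal{S}$ be a (relatively) open subset of $\mathcal{S}_w$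 and $\mathcal{S}^c:=\mathcal{S}_w\setminus\mathcal{S}$. Suppose there exist $\epsilon>0$, $\delta>0$ and reals $\bar\phi,\bar\phi_{\mathcal{S}^c}$ such that: $\bar\phi_{\mathcal{S}^c}\ge\bar\phi+3\delta$; $\phi(g,h)<\bar\phi+\delta$ with probability at least $1-\epsilon$; and $\phi_{\mathcal{S}^c}(g,h)>\bar\phi_{\mathcal{S}^c}-\delta$ with probability at least $1-\epsilon$. Then, with probability at least $1-2^{k+1}\epsilon$, every minimizer $w_\Phi(G)\in\arg\min_{w\in\mathcal{S}_w}\max_{v\in\mathcal{S}_v}\sum_{\ell}\beta_\ell(v_\ell)^TG_\ell\alpha_\ell(w)+\psi(w,v)$ lies in $\mathcal{S}$.
   Context: Norms are Euclidean. A function $\psi(w,v)$ is convex-concave if it is convex in $w$ for each fixed $v$ and concave in $v$ for each fixed $w$. *)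

(* Defs.v *)
From HB Require Import structures.
From mathcomp Require Import all_boot all_order all_algebra.
From mathcomp Require Import all_classical all_reals all_analysis.
From mathcomp Require Import normal_distribution.
Import Order.TTheory GRing.Theory Num.Theory.
Import numFieldNormedType.Exports.
Set Implicit Arguments. Unset Strict Implicit. Unset Printing Implicit Defensive.
Local Open Scope classical_set_scope.
Local Open Scope ring_scope.

Definition norm2 {R : realType} {m : nat} (x : 'cV[R]_m) : R :=
  Num.sqrt (\sum_(i < m) x i 0 ^+ 2).

Definition dotv {R : realType} {m : nat} (x y : 'cV[R]_m) : R := (x^T *m y) 0 0.

Definition vprod (R : realType) (k : nat) (n : 'I_k -> nat) :=
  prod_topology (fun l : 'I_k => 'cV[R]_(n l)).

Definition rel_open {T : topologicalType} (X S : set T) :=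
  S `<=` X /\ exists U, open U /\ S = U `&` X.

(* min_{w in T} max_{v in Sv} f w v, as inf/sup in the extended reals
   (inf over the empty set is +oo). *)
Definition minmax {R : realType} {W V : Type} (T : set W) (Sv : set V)
  (f : W -> V -> R) : \bar R :=
  ereal_inf [set ereal_sup [set (f w v)%:E | v in Sv] | w in T].

Definition maxv {R : realType} {W V : Type} (Sv : set V) (f : W -> V -> R) (w : W)
  : \bar R := ereal_sup [set (f w v)%:E | v in Sv].

(* The index set of all scalar Gaussian entries: for each l, the n_l x d entries
   of G_l, the d entries of g_l and the n_l entries of h_l. *)
Definition gidx (k d : nat) (n : 'I_k -> nat) : finType :=
  {l : 'I_k & ((('I_(n l) * 'I_d) + 'I_d) + 'I_(n l))%type}.

Definition gentries {R : realType} {T : Type} {k d : nat} {n : 'I_k -> nat}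
  (G : forall l : 'I_k, T -> 'M[R]_(n l, d)) (g : 'I_k -> T -> 'cV[R]_d)
  (h : forall l : 'I_k, T -> 'cV[R]_(n l)) (p : gidx d n) : T -> R :=
  let: existT l x := p in
  match x with
  | inl (inl (i, j)) => fun t => G l t i j
  | inl (inr j) => fun t => g l t j 0
  | inr i => fun t => h l t i 0
  end.

Definition iid_std_normal {dT : measure_display} {T : measurableType dT}
  {R : realType} (P : probability T R) (I : finType) (X : I -> T -> R) :=
  (forall i, measurable_fun setT (X i)) /\
  forall B : I -> set R, (forall i, measurable (B i)) ->
    P (\bigcap_(i in [set: I]) (X i @^-1` B i)) =
    (\prod_(i : I) normal_prob 0 1 (B i))%E.

Definition wp_atleast {dT : measure_display} {T : measurableType dT}
  {R : realType} (P : probability T R) (p : R) (Q : T -> Prop) :=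
  exists E : set T, measurable E /\ (p%:E <= P E)%E /\ (forall t, E t -> Q t).

Definition vset {R : realType} {k : nat} {n : 'I_k -> nat}
  (Sv : forall l : 'I_k, set 'cV[R]_(n l)) : set (vprod R n) :=
  [set v | forall l, Sv l (v l)].

Definition concave_in_v {R : realType} {k d : nat} {n : 'I_k -> nat}
  (Sw : set 'cV[R]_d) (Svset : set (vprod R n)) (psi : 'cV[R]_d -> vprod R n -> R) :=
  forall w, Sw w -> forall v v' : vprod R n, Svset v -> Svset v' ->
  forall t : R, 0 <= t <= 1 ->
    t * psi w v + (1 - t) * psi w v' <=
    psi w (fun l => t *: v l + (1 - t) *: v' l).

Definition convex_in_w {R : realType} {k d : nat} {n : 'I_k -> nat}
  (Sw : set 'cV[R]_d) (Svset : set (vprod R n)) (psi : 'cV[R]_d -> vprod R n -> R) :=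
  forall v, Svset v -> convex_function Sw (fun w => psi w v).

Definition affine {R : realType} {m : nat} (M : 'M[R]_m) (c : 'cV[R]_m) (x : 'cV[R]_m)
  : 'cV[R]_m := M *m x + c.

Definition PhiObj {R : realType} {k d : nat} {n : 'I_k -> nat}
  (A : 'I_k -> 'M[R]_d) (a : 'I_k -> 'cV[R]_d)
  (B : forall l, 'M[R]_(n l)) (b : forall l, 'cV[R]_(n l))
  (psi : 'cV[R]_d -> vprod R n -> R) (G : forall l, 'M[R]_(n l, d))
  (w : 'cV[R]_d) (v : vprod R n) : R :=
  \sum_(l < k) dotv (affine (B l) (b l) (v l)) (G l *m affine (A l) (a l) w) + psi w v.

Definition phiObj {R : realType} {k d : nat} {n : 'I_k -> nat}
  (A : 'I_k -> 'M[R]_d) (a : 'I_k -> 'cV[R]_d)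
  (B : forall l, 'M[R]_(n l)) (b : forall l, 'cV[R]_(n l))
  (psi : 'cV[R]_d -> vprod R n -> R) (g : 'I_k -> 'cV[R]_d) (h : forall l, 'cV[R]_(n l))
  (w : 'cV[R]_d) (v : vprod R n) : R :=
  \sum_(l < k) (norm2 (affine (B l) (b l) (v l)) * dotv (g l) (affine (A l) (a l) w)
               + norm2 (affine (A l) (a l) w) * dotv (h l) (affine (B l) (b l) (v l)))
  + psi w v.

(* Main.v *)
Require Import Defs.
From HB Require Import structures.
From mathcomp Require Import all_boot all_order all_algebra.
From mathcomp Require Import all_classical all_reals all_analysis.
From mathcomp Require Import measurable_realfun normal_distribution ring lra.
Import Order.TTheory GRing.Theory Num.Theory.
Import numFieldNormedType.Exports.
Set Implicit Arguments. Unset Strict Implicit. Unset Printing Implicit Defensive.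
Local Open Scope classical_set_scope.
Local Open Scope ring_scope.

(** Add to the bilinear process Phi one extra Gaussian term
    gamma_l |alpha_l(w)| |beta_l(v_l)| per block.  The covariance of the result
    minus that of phi at (w, v), (w', v') is
    sum_l (|alpha_l||alpha_l'| - <alpha_l, alpha_l'>) (|beta_l||beta_l'| - <beta_l, beta_l'>),
    which is nonnegative and vanishes when w = w' or v = v', so Gordon's
    comparison applies.  On the event that all gamma_l are nonpositive, of
    probability 2^-k, the extra terms only decrease the process; hence
    P(Phi_T < c) <= 2^k P(phi_T <= c).  With T the complement of S this bounds Phi
    from below there; exchanging the roles of w and v and the sign, together with
    the minimax theorem, it bounds Phi from above on S_w.

    Gordon's comparison is proved on the smooth function
    1 - prod_i (1 - prod_j sigmoid z_ij) by Lindeberg replacement: a standard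
    normal is a sum of n independent N(0, 1/n) increments, the increments are
    exchanged one at a time, and the second-order terms have the right sign.
    Expectations with respect to a Gaussian vector are written as compositions of
    one-dimensional Gaussian averages along the coefficient vectors, which commute;
    no Gaussian measure on R^N is needed.  Compact index sets are reached through
    a sequence of finite families that becomes dense. *)

(** * Gaussian integrals on the line *)

(** Gordon's comparison needs equal variances, whereas [phi] has variance 2 sum_l |alpha_l|^2
    |beta_l|^2 and [Phi] half of it; the terms in gamma_l supply the difference. The comparison only
    bounds a min-max from below. That suffices on the complement of S, which is in general not
    convex. On S_w a bound from above is wanted: a lower bound on min_v max_w of -Phi is an upper
    bound on max_v min_w of Phi, and only the passage from there to min_w max_v uses convexity. Each
    of the two bounds fails with probability at most 2^k eps, whence the factor 2^(k+1).

    The finite families filling a compact set grow at an unknown rate, and the error of the smooth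
    indicator is their cardinality times an exponential in minus scale times margin. Since the
    comparison holds at every scale, the scale is chosen after the family, as a logarithm of its
    size. *)

Definition image_measure d1 d2 (T1 : measurableType d1) (T2 : measurableType d2)
  (R : realFieldType) (m : {measure set T1 -> \bar R}) (f : T1 -> T2)
  (mf : measurable_fun setT f) : {measure set T2 -> \bar R} :=
  measure_function_pushforward__canonical__measure_function_Measure m mf.

Section gaussian.
Context {R : realType}.
Local Notation mu := (@lebesgue_measure R).
Local Notation gauss := (@normal_prob R 0 1).
Local Open Scope ereal_scope.

(** The Radon-Nikodym derivative of [normal_prob] equals [normal_pdf] almost everywhere, since both
    have the same integral over every measurable set; the rest is change of variables. *)
Lemma ge0_integral_normal_prob (m s : R) (f : R -> \bar R) : (s != 0)%R ->
  measurable_fun setT f -> (forall x, 0 <= f x) ->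
  \int[normal_prob m s]_x f x = \int[mu]_x (f x * (normal_pdf m s x)%:E).
Proof.
move=> s0 mf f0.
have dom := @normal_prob_dominates R m s.
rewrite -(Radon_Nikodym_SigmaFinite.change_of_variables dom)//.
have mpdf : measurable_fun setT (fun x => (normal_pdf m s x)%:E).
  by apply/measurable_EFinP; exact: measurable_normal_pdf.
have iRN := Radon_Nikodym_SigmaFinite.f_integrable dom.
apply: ae_eq_integral => //.
- apply: emeasurable_funM => //; exact: measurable_int iRN.
- exact: emeasurable_funM.
- apply: ae_eqe_mul2l => /=.
  apply: integral_ae_eq => //=.
  by move=> E _ mE; rewrite -Radon_Nikodym_SigmaFinite.f_integral.
Qed.

(** Lebesgue measure is the only measure giving half-open intervals their length, and the rescaled
    image measure does so. *)
Lemma lebesgue_measure_affine (m b : R) (A : set R) : (0 < b)%R -> measurable A ->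
  b%:E * pushforward mu (fun x : R => (m + b * x)%R : measurableTypeR R) A = mu A.
Proof.
move=> b0 mA.
have mphi : measurable_fun [set: measurableTypeR R]
    (fun x : measurableTypeR R => (m + b * x)%R : measurableTypeR R).
  by apply: measurable_funD => //; exact: measurable_funM.
pose phi := fun x : measurableTypeR R => (m + b * x)%R : measurableTypeR R.
have b0' : (0 <= b)%R by exact: ltW.
pose nu0 : {measure set (measurableTypeR R) -> \bar R} := image_measure mu mphi.
pose nu : {measure set _ -> \bar R} := mscale (NngNum b0') nu0.
rewrite -[LHS]/(nu A).
apply/esym/lebesgue_measure_unique => //= _ [[x y]] _ <-.
rewrite /nu /mscale /pushforward/=.
have phiE : phi @^-1` `]x, y]%classic = `](b^-1 * (x - m))%R, (b^-1 * (y - m))%R]%classic.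
  apply/seteqP; split => z; rewrite /phi/= !in_itv/= !ltr_pdivrMl// !ler_pdivlMl//;
   by move=> /andP[h1 h2]; apply/andP; split; lra.
rewrite [X in _ * mu X]phiE !lebesgue_measure_itv/= !lte_fin ltr_pM2l ?invr_gt0// ltrBDr subrK.
case: ifPn => _; last by rewrite mule0.
by rewrite -!EFinD -EFinM; congr EFin; field; lra.
Qed.

Lemma ge0_integral_affine (m b : R) (f : R -> \bar R) : (0 < b)%R ->
  measurable_fun setT f -> (forall x, 0 <= f x) ->
  b%:E * \int[mu]_x f (m + b * x)%R = \int[mu]_x f x.
Proof.
move=> b0 mf f0.
have mphi : measurable_fun [set: measurableTypeR R]
    (fun x : measurableTypeR R => (m + b * x)%R : measurableTypeR R).
  by apply: measurable_funD => //; exact: measurable_funM.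
pose phi := fun x : measurableTypeR R => (m + b * x)%R : measurableTypeR R.
have b0' : (0 <= b)%R by exact: ltW.
pose nu0 : {measure set (measurableTypeR R) -> \bar R} := image_measure mu mphi.
pose nu : {measure set _ -> \bar R} := mscale (NngNum b0') nu0.
transitivity (\int[nu]_x f x); last first.
  by apply: eq_measure_integral => //= A mA _; rewrite -(lebesgue_measure_affine m b0 mA).
rewrite ge0_integral_mscale//=; congr (_ * _).
by rewrite ge0_integral_pushforward.
Qed.

Lemma normal_pdfE' (m s : R) (x : R) : (s != 0)%R ->
  normal_pdf m s x = (normal_peak s * normal_fun m s x)%R.
Proof. by move=> s0; rewrite normal_pdfE. Qed.

Lemma normal_peakM (a b : R) : (0 < a)%R ->
  normal_peak (a * b) = (a^-1 * normal_peak b)%R.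
Proof.
move=> a0; rewrite /normal_peak exprMn -mulrA -mulrnAr sqrtrM ?sqr_ge0//.
by rewrite sqrtr_sqr gtr0_norm// invfM.
Qed.

Lemma ge0_integral_normal_affine (m b : R) (f : R -> \bar R) : (0 < b)%R ->
  measurable_fun setT f -> (forall x, 0 <= f x) ->
  \int[gauss]_x f (m + b * x)%R = \int[normal_prob m b]_x f x.
Proof.
move=> b0 mf f0; have b0' : (b != 0)%R by rewrite gt_eqF.
have mg : measurable_fun setT (fun x => f (m + b * x)%R).
  apply: (measurableT_comp mf).
  by apply: measurable_funD => //; exact: measurable_funM.
rewrite (ge0_integral_normal_prob 0 (oner_neq0 _) mg (fun x => f0 _)).
rewrite (ge0_integral_normal_prob m b0' mf f0).
have mpdf : measurable_fun setT (fun x => (normal_pdf m b x)%:E).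
  by apply/measurable_EFinP; exact: measurable_normal_pdf.
have mp01 : measurable_fun setT (fun x : R => (normal_pdf 0 1 x)%:E).
  by apply/measurable_EFinP; exact: measurable_normal_pdf.
rewrite -[RHS](ge0_integral_affine m b0); last 2 first.
- exact: emeasurable_funM.
- by move=> x; rewrite mule_ge0// lee_fin normal_pdf_ge0.
rewrite -ge0_integralZl//.
- apply: eq_integral => x _; rewrite [RHS]muleCA; congr (_ * _); rewrite -EFinM.
  congr EFin; rewrite !normal_pdfE' ?oner_neq0//.
  rewrite -[in RHS](mulr1 b) normal_peakM// mulr1 !mulrA mulfV// mul1r.
  congr (_ * expR _)%R; field; exact: b0'.
- apply: emeasurable_funM => //.
  apply: (@measurableT_comp _ _ _ _ _ _ (fun x => (normal_pdf m b x)%:E)) => //.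
  by apply: measurable_funD => //; exact: measurable_funM.
- by move=> x _; rewrite mule_ge0// lee_fin normal_pdf_ge0.
- by rewrite lee_fin ltW.
Qed.

(** For independent standard normal s, t and u = a s + b t, the joint density of (s, u) is
    symmetric; this is the symmetry of its exponent. *)
Lemma gauss_exponent_swap (a b s u : R) : (a ^+ 2 + b ^+ 2 = 1)%R -> (b != 0)%R ->
  (- (s - 0) ^+ 2 / (1 ^+ 2 *+ 2) + - (u - a * s) ^+ 2 / (b ^+ 2 *+ 2) =
   - (u - 0) ^+ 2 / (1 ^+ 2 *+ 2) + - (s - a * u) ^+ 2 / (b ^+ 2 *+ 2))%R.
Proof.
move=> ab b0.
have e : (s ^+ 2 * b ^+ 2 + (u - a * s) ^+ 2 = u ^+ 2 * b ^+ 2 + (s - a * u) ^+ 2)%R.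
  have -> : (b ^+ 2 = 1 - a ^+ 2)%R by rewrite -ab addrAC subrr add0r.
  by ring.
rewrite !subr0 expr1n.
have f (x y : R) : (- x ^+ 2 / 2 + - y ^+ 2 / (b ^+ 2 *+ 2) =
    - (x ^+ 2 * b ^+ 2 + y ^+ 2) / (b ^+ 2 *+ 2))%R by field.
by rewrite !f e.
Qed.

(** In the variables s and u = a s + b t the weight is the density of s times that of u given s. By
    symmetry it is also the density of u times that of s given u, and Tonelli's theorem integrates s
    out. *)
Lemma ge0_integral_gauss_add (a b : R) (f : R -> \bar R) :
  (a ^+ 2 + b ^+ 2 = 1)%R -> (0 < b)%R ->
  measurable_fun setT f -> (forall x, 0 <= f x) ->
  \int[gauss]_s \int[gauss]_t f (a * s + b * t)%R = \int[gauss]_x f x.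
Proof.
move=> ab b0 mf f0; have b0' : (b != 0)%R by rewrite gt_eqF.
have mpdf m c : measurable_fun setT (fun x : R => (normal_pdf m c x)%:E).
  by apply/measurable_EFinP; exact: measurable_normal_pdf.
have pdf0 (m c x : R) : 0 <= (normal_pdf m c x)%:E by rewrite lee_fin normal_pdf_ge0.
have m2 : measurable_fun [set: measurableTypeR R * measurableTypeR R]
    (fun x : measurableTypeR R * measurableTypeR R => f (a * x.1 + b * x.2)%R).
  apply: measurableT_comp => //; apply: measurable_funD;
  by apply: measurable_funM => //.
have mpdf2 : measurable_fun [set: R * R] (fun x : R * R => (normal_pdf (a * x.1) b x.2)%:E).
  apply/measurable_EFinP.
  have -> : (fun x : R * R => normal_pdf (a * x.1) b x.2) =
     (fun x : R * R => normal_pdf 0 b (x.2 - a * x.1)%R).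
    by apply/funext => x; rewrite !normal_pdfE' // /normal_fun subr0.
  apply: measurableT_comp; first exact: measurable_normal_pdf.
  by apply: measurable_funB => //; apply: measurable_funM.
transitivity (\int[mu]_s \int[mu]_u
   (f u * (normal_pdf 0 1 u)%:E * (normal_pdf (a * u) b s)%:E)).
  rewrite ge0_integral_normal_prob ?oner_neq0//; last 2 first.
  - exact: (measurable_fun_fubini_tonelli_F (m2 := gauss) _ m2 (fun=> f0 _)).
  - by move=> x; exact: integral_ge0.
  apply: eq_integral => s _.
  rewrite ge0_integral_normal_affine// ge0_integral_normal_prob//.
  rewrite muleC -[LHS](ge0_integralZl mu measurableT
    (emeasurable_funM mf (mpdf (a * s)%R b)) (fun x _ => mule_ge0 (f0 x) (pdf0 _ _ x)) (pdf0 _ _ _)).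
  apply: eq_integral => u _; rewrite muleCA -!muleA; congr (_ * _).
  rewrite -!EFinM; congr EFin; rewrite !normal_pdfE' ?oner_neq0//.
  rewrite mulrACA [RHS]mulrACA; congr (_ * _)%R; rewrite -!expRD; congr expR.
  exact: gauss_exponent_swap.
have mint : measurable_fun [set: measurableTypeR R * measurableTypeR R]
    (fun x : measurableTypeR R * measurableTypeR R =>
    f x.2 * (normal_pdf 0 1 x.2)%:E * (normal_pdf (a * x.2) b x.1)%:E).
  apply: emeasurable_funM.
    apply: emeasurable_funM; first exact: (measurableT_comp mf measurable_snd).
    exact: (measurableT_comp (mpdf 0 1)%R measurable_snd).
  exact: (measurableT_comp mpdf2 (@measurable_swap _ _ _ _)).
have gint (x : R * R) : 0 <= f x.2 * (normal_pdf 0 1 x.2)%:E * (normal_pdf (a * x.2) b x.1)%:E.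
  by rewrite !mule_ge0.
rewrite (@fubini_tonelli _ _ _ _ _ mu mu (fun x : R * R =>
    f x.2 * (normal_pdf 0 1 x.2)%:E * (normal_pdf (a * x.2) b x.1)%:E) mint gint)/=.
rewrite ge0_integral_normal_prob ?oner_neq0//.
apply: eq_integral => u _.
rewrite (ge0_integralZl mu measurableT (mpdf (a * u)%R b)
  (fun x _ => pdf0 _ _ x) (mule_ge0 (f0 u) (pdf0 _ _ u))).
by rewrite integral_normal_pdf mule1.
Qed.

Lemma ge0_integral_gaussN (f : R -> \bar R) :
  measurable_fun setT f -> (forall x, 0 <= f x) ->
  \int[gauss]_x f (- x)%R = \int[gauss]_x f x.
Proof.
move=> mf f0.
rewrite !ge0_integral_normal_prob ?oner_neq0//; last exact: measurableT_comp.
pose F x := (f x * (normal_pdf 0 1 x)%:E).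
have mp01 : measurable_fun setT (fun x : R => (normal_pdf 0 1 x)%:E).
  by apply/measurable_EFinP; exact: measurable_normal_pdf.
have mF : measurable_fun setT F by exact: emeasurable_funM.
transitivity (\int[mu]_x F (- x)%R).
  apply: eq_integral => x _; rewrite /F; congr (_ * _%:E).
  by rewrite !normal_pdfE' ?oner_neq0// /normal_fun !subr0 sqrrN.
transitivity (\int[pushforward mu (-%R : _ -> measurableTypeR R)]_x F x).
  rewrite ge0_integral_pushforward//.
  by move=> x _; rewrite mule_ge0// lee_fin normal_pdf_ge0.
by apply: eq_measure_integral => //= A mA _; rewrite lebesgue_measureN.
Qed.

(** Multiplied by the standard density, exp(x^2/4) becomes sqrt 2 times the density of variance 2.
    It serves below as the common dominating function for moments. *)
Lemma integral_gauss_expR_lty :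
  \int[gauss]_x (expR (x ^+ 2 / 4))%:E < +oo.
Proof.
have mexp : measurable_fun setT (fun x : R => (expR (x ^+ 2 / 4))%:E).
  apply/measurable_EFinP; apply: measurableT_comp => //.
  by apply: measurable_funM => //; exact: measurable_funX.
rewrite ge0_integral_normal_prob ?oner_neq0//.
pose s : R := Num.sqrt 2.
have s0 : (0 < s)%R by rewrite sqrtr_gt0.
have s2 : (s ^+ 2 = 2)%R by rewrite sqr_sqrtr.
have -> : \int[mu]_x ((expR (x ^+ 2 / 4))%:E * (normal_pdf 0 1 x)%:E) =
    \int[mu]_x (s%:E * (normal_pdf 0 s x)%:E).
  apply: eq_integral => x _; rewrite -!EFinM !normal_pdfE' ?oner_neq0 ?gt_eqF//.
  rewrite -[in RHS](mulr1 s) normal_peakM// mulr1 -[in RHS]mulrA mulVKf ?gt_eqF//.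
  rewrite mulrCA -expRD; congr (_ * expR _)%:E.
  by rewrite s2 !subr0; field.
have mpdf : measurable_fun setT (fun x : R => (normal_pdf 0 s x)%:E).
  by apply/measurable_EFinP; exact: measurable_normal_pdf.
have pdf0 (x : R) : 0 <= (normal_pdf 0 s x)%:E by rewrite lee_fin normal_pdf_ge0.
have sE : 0 <= s%:E by rewrite lee_fin ltW.
by rewrite (ge0_integralZl mu measurableT mpdf (fun x _ => pdf0 x) sE) integral_normal_pdf mule1 ltry.
Qed.

End gaussian.

(** * Averaging along a Gaussian direction *)

Section gauss_operator.
Context {R : realType} {K : finType}.
Local Notation V := {ffun K -> R}.
Local Notation gauss := (@normal_prob R 0 1).

(** Borel measurability on R^K, tested by composition with coordinatewise measurable maps, so that
    [V] carries no sigma-algebra. *)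
Definition umeasurable (F : V -> R) :=
  forall d (T : measurableType d) (z : T -> V),
    (forall k, measurable_fun setT (fun t => z t k)) ->
    measurable_fun setT (F \o z).

Definition ubounded (F : V -> R) := exists M, forall z, `|F z| <= M.

Definition bmeas (F : V -> R) := umeasurable F /\ ubounded F.

Definition gaussop (x : V) (F : V -> R) (z : V) : R :=
  \int[gauss]_s F (z + (s : R) *: x).

Definition gaussops (xs : seq V) (F : V -> R) : V -> R := foldr gaussop F xs.

Lemma measurable_line d (T : measurableType d) (u : T -> R) (z : T -> V) (x : V) :
  measurable_fun setT u -> (forall k, measurable_fun setT (fun t => z t k)) ->
  forall k, measurable_fun setT (fun t => (z t + u t *: x) k).
Proof.
move=> mu mz k.
rewrite (_ : (fun _ => _) = (fun t => z t k + u t * x k)); last first.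
  by apply/funext => t; rewrite !ffunE.
by apply: measurable_funD => //; exact: measurable_funM.
Qed.

Lemma measurable_bmeas_line (F : V -> R) (z x : V) : umeasurable F ->
  measurable_fun [set: measurableTypeR R] (fun s : measurableTypeR R => F (z + (s : R) *: x)).
Proof.
move=> mF; apply: (mF _ (measurableTypeR R) (fun s => z + (s : R) *: x)).
exact: (@measurable_line _ _ id (fun=> z)).
Qed.

Lemma bounded_integrable d (T : measurableType d) (P : probability T R) (f : T -> R) M :
  measurable_fun setT f -> (forall t, `|f t| <= M) ->
  P.-integrable setT (EFin \o f).
Proof.
move=> mf fM; apply: (@le_integrable _ _ _ P _ measurableT _ (EFin \o cst M)).
- exact/measurable_EFinP.
- by move=> t _ /=; rewrite lee_fin (le_trans (fM t))// ler_norm.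
- exact: finite_measure_integrable_cst.
Qed.

Lemma gaussop_integrable (F : V -> R) (z x : V) : bmeas F ->
  gauss.-integrable setT (fun s => (F (z + (s : R) *: x))%:E).
Proof.
move=> [mF [M FM]]; apply: (@bounded_integrable _ _ gauss (fun s => F (z + (s : R) *: x)) M) => //.
exact: measurable_bmeas_line.
Qed.

Lemma gaussopE (F : V -> R) (z x : V) : bmeas F ->
  (gaussop x F z)%:E = (\int[gauss]_s (F (z + (s : R) *: x))%:E)%E.
Proof.
move=> bF; rewrite /gaussop /Rintegral fineK//.
apply: integrable_fin_num => //; exact: gaussop_integrable.
Qed.

Lemma gauss_setT : fine (gauss setT) = 1.
Proof. by rewrite probability_setT. Qed.

Lemma gaussop_cst (x : V) (c : R) (z : V) : gaussop x (fun=> c) z = c.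
Proof. by rewrite /gaussop Rintegral_cst// gauss_setT mulr1. Qed.

Lemma bmeas_cst (c : R) : bmeas (fun=> c).
Proof. by split; [move=> d T z _; exact: measurable_cst|exists `|c|]. Qed.

Lemma bmeasD (F G : V -> R) : bmeas F -> bmeas G -> bmeas (fun z => F z + G z).
Proof.
move=> [mF [M FM]] [mG [N GN]]; split.
- by move=> d T z mz; apply: measurable_funD; [exact: mF|exact: mG].
- by exists (M + N) => z; rewrite (le_trans (ler_normD _ _))// lerD.
Qed.

Lemma bmeasM (F G : V -> R) : bmeas F -> bmeas G -> bmeas (fun z => F z * G z).
Proof.
move=> [mF [M FM]] [mG [N GN]]; split.
- by move=> d T z mz; apply: measurable_funM; [exact: mF|exact: mG].
- by exists (M * N) => z; rewrite normrM ler_pM.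
Qed.

Lemma bmeas_sum (I : Type) (r : seq I) (P : pred I) (F : I -> V -> R) :
  (forall i, bmeas (F i)) -> bmeas (fun z => \sum_(i <- r | P i) F i z).
Proof.
move=> bF; elim: r => [|i r IH].
  rewrite (_ : (fun _ => _) = fun=> 0); first exact: bmeas_cst.
  by apply/funext => z; rewrite big_nil.
case Pi : (P i).
  rewrite (_ : (fun _ => _) = fun z => F i z + \sum_(i <- r | P i) F i z).
    exact: bmeasD.
  by apply/funext => z; rewrite big_cons Pi.
rewrite (_ : (fun _ => _) = fun z => \sum_(i <- r | P i) F i z)//.
by apply/funext => z; rewrite big_cons Pi.
Qed.

Lemma gaussopD (F G : V -> R) (x z : V) : bmeas F -> bmeas G ->
  gaussop x (fun z => F z + G z) z = gaussop x F z + gaussop x G z.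
Proof.
by move=> bF bG; rewrite /gaussop RintegralD//; exact: gaussop_integrable.
Qed.

Lemma gaussopZ (F : V -> R) (c : R) (x z : V) : bmeas F ->
  gaussop x (fun z => c * F z) z = c * gaussop x F z.
Proof.
by move=> bF; rewrite /gaussop RintegralZl//; exact: gaussop_integrable.
Qed.

Lemma le_gaussop (F G : V -> R) (x z : V) : bmeas F -> bmeas G ->
  (forall z, F z <= G z) -> gaussop x F z <= gaussop x G z.
Proof.
by move=> bF bG FG; apply: le_Rintegral => //; exact: gaussop_integrable.
Qed.

Lemma gaussop_ge0 (F : V -> R) (x z : V) :
  (forall z, 0 <= F z) -> 0 <= gaussop x F z.
Proof. by move=> F0; exact: Rintegral_ge0. Qed.

Lemma gaussop_norm_le (F : V -> R) (x : V) M : bmeas F -> (forall z, `|F z| <= M) ->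
  forall z, `|gaussop x F z| <= M.
Proof.
move=> bF FM z; rewrite ler_norml; apply/andP; split.
  rewrite -(gaussop_cst x (- M) z); apply: le_gaussop => //; first exact: bmeas_cst.
  by move=> y; have := FM y; rewrite ler_norml => /andP[].
rewrite -(gaussop_cst x M z); apply: le_gaussop => //; first exact: bmeas_cst.
by move=> y; have := FM y; rewrite ler_norml => /andP[].
Qed.

Lemma gaussopDc (F : V -> R) (c : R) (x z : V) : bmeas F ->
  gaussop x (fun z => F z + c) z = gaussop x F z + c.
Proof.
move=> bF; rewrite (@gaussopD F (fun=> c))//; last exact: bmeas_cst.
by rewrite gaussop_cst.
Qed.

Lemma bmeas_gaussop (x : V) (F : V -> R) : bmeas F -> bmeas (gaussop x F).
Proof.
move=> bF; have [mF [M FM]] := bF.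
split; last by exists M; exact: gaussop_norm_le.
move=> d T z mz.
apply/measurable_EFinP.
(* Adding the bound [M] makes the integrand nonnegative, as Tonelli's measurability statement
   requires. *)
have m2 : measurable_fun [set: T * measurableTypeR R]
    (fun p : T * measurableTypeR R => F (z p.1 + (p.2 : R) *: x) + M).
  apply: measurable_funD => //.
  apply: (mF _ (T * measurableTypeR R)%type (fun p => z p.1 + (p.2 : R) *: x)).
  apply: (@measurable_line _ _ snd (fun p : T * measurableTypeR R => z p.1)).
    exact: measurable_snd.
  by move=> k; exact: (measurableT_comp (mz k) measurable_fst).
have /(_ _)/= := @measurable_fun_fubini_tonelli_F _ _ T (measurableTypeR R) R gauss
  (fun p => (F (z p.1 + (p.2 : R) *: x) + M)%:E).
have -> : fubini_F gauss (fun p : T * measurableTypeR R => (F (z p.1 + (p.2 : R) *: x) + M)%:E)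
   = fun t => (gaussop x F (z t) + M)%:E.
  apply/funext => t; rewrite -gaussopDc// gaussopE//.
  by apply: bmeasD => //; exact: bmeas_cst.
have h0 p : (0 <= (F (z p.1 + (p.2 : measurableTypeR R) *: x) + M)%:E)%E.
  rewrite lee_fin -lerBlDr sub0r; set u := _ + _.
  by have := FM u; rewrite ler_norml => /andP[].
have /measurable_EFinP m2' := m2.
move=> /(_ m2' h0) /measurable_EFinP H; apply/measurable_EFinP.
have -> : gaussop x F \o z = (fun t => (gaussop x F (z t) + M) - M).
  by apply/funext => t /=; rewrite addrK.
exact: measurable_funB.
Qed.

Lemma gaussopC (x y : V) (F : V -> R) : bmeas F ->
  gaussop x (gaussop y F) = gaussop y (gaussop x F).
Proof.
wlog F0 : F / forall z, 0 <= F z.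
  move=> H bF; have [mF [M FM]] := bF; apply/funext => z.
  have := H (fun z => F z + M).
  have h0 z' : 0 <= F z' + M.
    by rewrite -lerBlDr sub0r; have := FM z'; rewrite ler_norml => /andP[].
  have bFM : bmeas (fun z => F z + M) by apply: bmeasD => //; exact: bmeas_cst.
  move=> /(_ h0 bFM)/(congr1 (fun f => f z))/=.
  rewrite (_ : gaussop x (fun z => F z + M) = fun z => gaussop x F z + M); last first.
    by apply/funext => z'; rewrite gaussopDc.
  rewrite (_ : gaussop y (fun z => F z + M) = fun z => gaussop y F z + M); last first.
    by apply/funext => z'; rewrite gaussopDc.
  by rewrite !gaussopDc; [move/addIr|exact: bmeas_gaussop..].
move=> bF; apply/funext => z; apply: EFin_inj.
have [mF _] := bF.
rewrite (gaussopE _ _ (bmeas_gaussop y bF)) (gaussopE _ _ (bmeas_gaussop x bF)).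
under eq_integral do rewrite (gaussopE _ _ bF).
under [RHS]eq_integral do rewrite (gaussopE _ _ bF).
rewrite (@fubini_tonelli _ _ _ _ R gauss gauss
   (fun p : measurableTypeR R * measurableTypeR R =>
      (F (z + (p.1 : R) *: x + (p.2 : R) *: y))%:E))/=; last 2 first.
- apply/measurable_EFinP.
  apply: (mF _ (measurableTypeR R * measurableTypeR R)%type
    (fun p => z + (p.1 : R) *: x + (p.2 : R) *: y)).
  apply: (@measurable_line _ _ snd (fun p : measurableTypeR R * measurableTypeR R =>
    z + (p.1 : R) *: x)); first exact: measurable_snd.
  by apply: (@measurable_line _ _ fst (fun=> z)) => //; exact: measurable_fst.
- by move=> p; rewrite lee_fin.
by apply: eq_integral => s _; apply: eq_integral => t _; rewrite addrAC.
Qed.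

Lemma gaussop_add (a b : R) (x : V) (F : V -> R) : bmeas F ->
  a ^+ 2 + b ^+ 2 = 1 -> 0 < b ->
  gaussop (a *: x) (gaussop (b *: x) F) = gaussop x F.
Proof.
move=> bF ab b0; wlog F0 : F bF / forall z, 0 <= F z.
  move=> H; have [mF [M FM]] := bF; apply/funext => z.
  have := H (fun z => F z + M).
  have h0 z' : 0 <= F z' + M.
    by rewrite -lerBlDr sub0r; have := FM z'; rewrite ler_norml => /andP[].
  have bFM : bmeas (fun z => F z + M) by apply: bmeasD => //; exact: bmeas_cst.
  move=> /(_ bFM h0)/(congr1 (fun f => f z))/=.
  rewrite (_ : gaussop (b *: x) (fun z => F z + M) = fun z => gaussop (b *: x) F z + M); last first.
    by apply/funext => z'; rewrite gaussopDc.
  by rewrite !gaussopDc//; [move/addIr|exact: bmeas_gaussop..].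
apply/funext => z; apply: EFin_inj; have [mF _] := bF.
have F0' y : (0 <= (F y)%:E)%E by rewrite lee_fin.
rewrite (gaussopE _ _ (bmeas_gaussop (b *: x) bF)) (gaussopE _ _ bF).
under eq_integral do rewrite (gaussopE _ _ bF).
have mE : measurable_fun [set: measurableTypeR R]
    (fun u : measurableTypeR R => (F (z + (u : R) *: x))%:E).
  by apply/measurable_EFinP; exact: measurable_bmeas_line.
rewrite -(ge0_integral_gauss_add ab b0 mE (fun u => F0' _)).
apply: eq_integral => s _; apply: eq_integral => t _.
by rewrite !scalerA [(s * a)%R]mulrC [(t * b)%R]mulrC scalerDl addrA.
Qed.

Lemma bmeas_gaussops (xs : seq V) (F : V -> R) : bmeas F -> bmeas (gaussops xs F).
Proof. by move=> bF; elim: xs => //= x xs; exact: bmeas_gaussop. Qed.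

Lemma gaussops_cat xs ys (F : V -> R) :
  gaussops (xs ++ ys) F = gaussops xs (gaussops ys F).
Proof. by rewrite /gaussops foldr_cat. Qed.

Lemma gaussop_gaussops x xs (F : V -> R) : bmeas F ->
  gaussop x (gaussops xs F) = gaussops xs (gaussop x F).
Proof.
move=> bF; elim: xs => //= y xs <-; rewrite gaussopC//; exact: bmeas_gaussops.
Qed.

Lemma gaussopsC xs ys (F : V -> R) : bmeas F ->
  gaussops xs (gaussops ys F) = gaussops ys (gaussops xs F).
Proof.
move=> bF; elim: xs => //= x xs IH; rewrite IH gaussop_gaussops//.
exact: bmeas_gaussops.
Qed.

Lemma le_gaussops xs (F G : V -> R) : bmeas F -> bmeas G ->
  (forall z, F z <= G z) -> forall z, gaussops xs F z <= gaussops xs G z.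
Proof.
move=> bF bG FG; elim: xs => //= x xs IH z.
by apply: le_gaussop => //; exact: bmeas_gaussops.
Qed.

Lemma gaussopsDc xs (F : V -> R) (c : R) z : bmeas F ->
  gaussops xs (fun z => F z + c) z = gaussops xs F z + c.
Proof.
move=> bF; elim: xs z => //= x xs IH z.
rewrite (_ : gaussops xs _ = fun z => gaussops xs F z + c); last exact/funext.
by rewrite gaussopDc//; exact: bmeas_gaussops.
Qed.

End gauss_operator.

(** * Second-order expansions *)

Section taylor.
Context {R : realType} {K : finType}.
Local Notation V := {ffun K -> R}.
Local Notation gauss := (@normal_prob R 0 1).

Definition norm1 (u : V) : R := \sum_k `|u k|.

(** [p] is the gradient, tested along lines only, so that all the calculus is in one real
    variable. *)
Definition line_derivable (F : V -> R) (p : K -> V -> R) :=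
  forall (z u : V) (s : R),
    is_derive s (1 : R) (fun s : R => F (z + s *: u)) (\sum_k p k (z + s *: u) * u k).

Definition lipschitz1 (F : V -> R) :=
  exists2 L, 0 <= L & forall z u, `|F (z + u) - F z| <= L * norm1 u.

(** The Lipschitz bound on the Hessian [q] stands in for third derivatives: it makes the Taylor
    remainder cubic, uniformly in the base point. *)
Definition smooth2 (F : V -> R) (p : K -> V -> R) (q : K -> K -> V -> R) :=
  [/\ bmeas F, (forall k, bmeas (p k)) & (forall k l, bmeas (q k l))] /\
  [/\ line_derivable F p, (forall k, line_derivable (p k) (q k)) &
      (forall k l, lipschitz1 (q k l))].

Lemma norm1_ge0 u : 0 <= norm1 u.
Proof. by apply: sumr_ge0 => k _. Qed.

Lemma norm1Z (s : R) u : norm1 (s *: u) = `|s| * norm1 u.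
Proof. by rewrite /norm1 mulr_sumr; apply: eq_bigr => k _; rewrite ffunE normrM. Qed.

Lemma norm_sum_coord_le (a : K -> R) (u : V) (M : R) :
  (forall k, `|a k| <= M) -> `|\sum_k a k * u k| <= M * norm1 u.
Proof.
move=> aM; apply: (le_trans (ler_norm_sum _ _ _)).
rewrite /norm1 mulr_sumr; apply: ler_sum => k _.
by rewrite normrM ler_wpM2r.
Qed.

Lemma derive_bound (f df : R -> R) (M : R) :
  (forall s, is_derive s (1 : R) f (df s)) ->
  (forall s, 0 <= s <= 1 -> `|df s| <= M) ->
  forall s, 0 <= s <= 1 -> `|f s - f 0| <= M.
Proof.
move=> fd dfM s /andP[s0 s1].
have M0 : 0 <= M by apply: le_trans (dfM 0 _); rewrite ?lexx ?ler01.
have [c cs ->] : exists2 c, c \in `[0, s]%R & f s - f 0 = df c * (s - 0).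
  apply: (MVT_segment s0 (fun x _ => fd x)).
  by apply: derivable_within_continuous => x _; exact: (@ex_derive _ _ _ _ _ _ _ (fd x)).
move: cs; rewrite in_itv/= subr0 normrM (ger0_norm s0) => /andP[c0 cs].
rewrite -[leRHS]mulr1 ler_pM// dfM// c0/=; exact: le_trans cs s1.
Qed.

Lemma line_derivable_lipschitz (F : V -> R) p :
  line_derivable F p -> (forall k, bmeas (p k)) -> lipschitz1 F.
Proof.
move=> Fp bp.
have [M pM] : exists M, forall k z, `|p k z| <= M.
  have /choice[M HM] k : exists M, forall z, `|p k z| <= M by case: (bp k) => _ [M ?]; exists M.
  exists (\sum_k `|M k|) => k z; apply: (le_trans (HM k z)).
  rewrite (bigD1 k)//=; apply: (le_trans (ler_norm _)).
  by rewrite lerDl; apply: sumr_ge0.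
exists `|M| => // z u.
have := @derive_bound _ _ (`|M| * norm1 u) (Fp z u).
move=> /(_ _ 1); rewrite scale1r scale0r addr0; apply; last by rewrite ler01 lexx.
move=> s _; apply: norm_sum_coord_le => k; exact: le_trans (pM _ _) (ler_norm _).
Qed.

(** The mean value inequality is used twice along the segment: for [r k], a partial derivative minus
    its linearisation, and for [g], the function minus its quadratic part, whose derivative is a
    combination of increments of the [r k]. *)
Lemma smooth2_taylor (F : V -> R) p q : smooth2 F p q ->
  exists2 C, 0 <= C & forall z u,
  `|F (z + u) - F z - \sum_k p k z * u k
     - 2^-1 * \sum_k (\sum_l q k l z * u l) * u k| <= C * norm1 u ^+ 3.
Proof.
move=> [[bF bp bq] [Fp pq qL]].
have [L L0 HL] : exists2 L, 0 <= L & forall k l z u, `|q k l (z + u) - q k l z| <= L * norm1 u.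
  have /choice[L HL] (kl : K * K) : exists L, 0 <= L /\ forall z u,
      `|q kl.1 kl.2 (z + u) - q kl.1 kl.2 z| <= L * norm1 u.
    by have [L L0 HL] := qL kl.1 kl.2; exists L.
  exists (\sum_kl L kl); first by apply: sumr_ge0 => kl _; case: (HL kl).
  move=> k l z u; apply: (le_trans ((HL (k, l)).2 z u)).
  rewrite ler_wpM2r ?norm1_ge0// (bigD1 (k, l))//= lerDl.
  by apply: sumr_ge0 => kl _; case: (HL kl).
exists L => // z u; set N := norm1 u; have N0 : 0 <= N := norm1_ge0 u.
pose r k (s : R) := p k (z + s *: u) - s * \sum_l q k l z * u l.
have rd k s : is_derive s (1 : R) (r k) (\sum_l (q k l (z + s *: u) - q k l z) * u l).
  have H1 := pq k z u s.
  apply: is_derive_eq.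
  rewrite scaler0 add0r -[_%:A]/(_ * 1) mulr1 -sumrB.
  by apply: eq_bigr => l _; rewrite mulrBl.
have rB k s : 0 <= s <= 1 -> `|r k s - r k 0| <= L * N ^+ 2.
  apply: derive_bound (rd k) _ s => s /andP[s0 s1].
  rewrite expr2 mulrA; apply: norm_sum_coord_le => l.
  apply: (le_trans (HL _ _ _ _)); rewrite norm1Z (ger0_norm s0) ler_wpM2l//.
  by rewrite ler_piMl.
pose g (s : R) := F (z + s *: u) - s * (\sum_k p k z * u k)
   - (2^-1 * s ^+ 2) * \sum_k (\sum_l q k l z * u l) * u k.
have gd s : is_derive s (1 : R) g (\sum_k (r k s - r k 0) * u k).
  have H1 := Fp z u s.
  apply: is_derive_eq.
  rewrite !scaler0 !add0r -[(\sum_k p k z * u k)%:A]/(_ * 1) mulr1.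
  rewrite -[s%:A]/(s * 1) mulr1.
  rewrite (_ : _ *: (2^-1 *: (s + s)) = s * \sum_k (\sum_l q k l z * u l) * u k); last first.
    by rewrite -[LHS]/(_ * (_ * _)); field.
  rewrite mulr_sumr -!sumrB; apply: eq_bigr => k _.
  by rewrite /r scale0r addr0 mul0r subr0; ring.
have := @derive_bound _ _ (L * N ^+ 3) gd.
rewrite /g => /(_ _ 1).
rewrite scale1r scale0r addr0 expr1n expr0n/= mulr0 !mul0r !subr0 mulr1 mul1r => H.
rewrite (_ : _ - _ - _ - _ = F (z + u) - \sum_k p k z * u k -
  2^-1 * (\sum_k (\sum_l q k l z * u l) * u k) - F z); last by ring.
apply: H; last by rewrite ler01 lexx.
move=> s s01; rewrite exprSr mulrA; apply: norm_sum_coord_le => k; exact: rB.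
Qed.

End taylor.

(** * Moments of the standard normal law *)

Section moments.
Context {R : realType}.
Local Notation gauss := (@normal_prob R 0 1).
Local Notation RR := (measurableTypeR R).

Lemma gauss_integrable (f : RR -> R) (C : R) : measurable_fun setT f ->
  (forall s : R, `|f s| <= C * expR (s ^+ 2 / 4)) ->
  gauss.-integrable setT (EFin \o f).
Proof.
move=> mf fC.
have mexp : measurable_fun [set: RR] (fun x : RR => expR ((x : R) ^+ 2 / 4)).
  apply: measurableT_comp => //.
  by apply: measurable_funM => //; exact: measurable_funX.
have iexp : gauss.-integrable [set: RR] (fun x : RR => (expR ((x : R) ^+ 2 / 4))%:E).
  apply/integrableP; split; first exact/measurable_EFinP.
  under eq_integral do rewrite abse_EFin ger0_norm ?expR_ge0//.
  exact: integral_gauss_expR_lty.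
apply: (@le_integrable _ _ _ gauss _ measurableT _ (fun x : RR => (C * expR ((x : R) ^+ 2 / 4))%:E)).
- exact/measurable_EFinP.
- by move=> s _ /=; rewrite lee_fin (le_trans (fC s))// ler_norm.
- exact: (integrableZl _ C iexp).
Qed.

Lemma sqr_le_expR4 (s : R) : s ^+ 2 <= 4 * expR (s ^+ 2 / 4).
Proof. by have := expR_ge1Dx (s ^+ 2 / 4); lra. Qed.

(** exp(s^2/4) is the square of exp(s^2/8) >= 1 + s^2/8, hence 64 = 8^2. *)
Lemma pow4_le_expR4 (s : R) : s ^+ 4 <= 64 * expR (s ^+ 2 / 4).
Proof.
have e : expR (s ^+ 2 / 4) = expR (s ^+ 2 / 8) ^+ 2.
  by rewrite -expRM_natl -mulr_natl; congr expR; field.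
have h := expR_ge1Dx (s ^+ 2 / 8).
have s0 : 0 <= s ^+ 2 by exact: sqr_ge0.
rewrite e; set y := expR _ in h *.
rewrite (_ : s ^+ 4 = (s ^+ 2) ^+ 2); last by rewrite -exprM.
by nra.
Qed.

Lemma gauss_integrable_id : gauss.-integrable setT (EFin \o (id : RR -> R)).
Proof.
apply: (@gauss_integrable _ 4) => // s.
have := sqr_le_expR4 s; have := sqr_ge0 (`|s| - 1).
have : s ^+ 2 = `|s| ^+ 2 by rewrite real_normK// num_real.
move=> ->; have := expR_ge1Dx (`|s| ^+ 2 / 4).
have := sqr_ge0 (`|s|); nra.
Qed.

Lemma gauss_integrable_norm : gauss.-integrable setT (EFin \o (fun s : RR => `|s : R|)).
Proof. exact: integrable_norm gauss_integrable_id. Qed.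

Lemma gauss_integrable_sqr : gauss.-integrable setT (EFin \o (fun s : RR => (s : R) ^+ 2)).
Proof.
apply: (@gauss_integrable _ 4) => [|s]; first exact: measurable_funX.
by rewrite ger0_norm ?sqr_ge0// sqr_le_expR4.
Qed.

Lemma gauss_integrable_cube : gauss.-integrable setT (EFin \o (fun s : RR => `|s : R| ^+ 3)).
Proof.
(* 68 = 64 + 4: since s^2 (|s| - 1)^2 >= 0, the cube |s|^3 is at most s^4 + s^2. *)
apply: (@gauss_integrable _ 68) => [|s].
  apply: measurable_funX; apply/measurable_EFinP.
  exact: (measurable_int _ gauss_integrable_norm).
have h2 := sqr_le_expR4 s; have h4 := pow4_le_expR4 s.
rewrite ger0_norm; last exact: exprn_ge0.
have e2 : s ^+ 2 = `|s| ^+ 2 by rewrite real_normK// num_real.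
have e4 : s ^+ 4 = `|s| ^+ 4 by rewrite -normrX ger0_norm// exprn_even_ge0.
have : 0 <= `|s| ^+ 2 * (`|s| - 1) ^+ 2 by rewrite mulr_ge0 ?sqr_ge0.
have -> : `|s| ^+ 2 * (`|s| - 1) ^+ 2 = s ^+ 4 - 2 * `|s| ^+ 3 + s ^+ 2.
  by rewrite e4 e2; ring.
have : 0 <= s ^+ 4 by exact: exprn_even_ge0.
have : 0 <= s ^+ 2 by exact: sqr_ge0.
by lra.
Qed.

(** By symmetry of the law, the positive and negative parts of the identity have the same
    integral. *)
Lemma gauss_mean : \int[gauss]_s (s : R) = 0.
Proof.
have h : (\int[gauss]_s ((fun s : RR => (s : R)%:E)^\+ s) = \int[gauss]_s ((fun s : RR => (s : R)%:E)^\- s))%E.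
  rewrite -(ge0_integral_gaussN (f := (fun s : R => s%:E)^\+%E)).
  - by apply: eq_integral => s _; rewrite funeposE funenegE EFinN.
  - exact: (measurable_funepos (measurable_int _ gauss_integrable_id)).
  - by move=> s; rewrite funeposE le_max lexx orbT.
rewrite /Rintegral integralE h subee//.
apply: integrable_fin_num => //.
exact: (integrable_funeneg _ gauss_integrable_id).
Qed.

End moments.

(** * One small Gaussian increment, to second order *)

Section step.
Context {R : realType} {K : finType}.
Local Notation V := {ffun K -> R}.
Local Notation gauss := (@normal_prob R 0 1).
Local Notation RR := (measurableTypeR R).
Local Notation var := (\int[gauss]_s (s : R) ^+ 2).
Local Notation c1 := (\int[gauss]_s `|s : R|).
Local Notation c3 := (\int[gauss]_s `|s : R| ^+ 3).

Definition quadr (q : K -> K -> V -> R) (x : V) (z : V) :=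
  \sum_k (\sum_l q k l z * x l) * x k.

Lemma ffunZE (a : R) (v : V) k : (a *: v) k = a * v k.
Proof. by rewrite ffunE. Qed.

Lemma gauss_moment_ge0 (f : RR -> R) : (forall s, 0 <= f s) -> 0 <= \int[gauss]_s f s.
Proof. by move=> f0; exact: Rintegral_ge0. Qed.

Lemma gaussop_lip (F : V -> R) (x : V) : bmeas F -> lipschitz1 F ->
  exists2 C, 0 <= C & forall r z, 0 <= r -> `|gaussop (r *: x) F z - F z| <= C * r.
Proof.
move=> bF [L L0 FL].
exists (L * norm1 x * c1).
  by rewrite !mulr_ge0 ?norm1_ge0// gauss_moment_ge0.
move=> r z r0.
have iF := gaussop_integrable z (r *: x) bF.
have iD : gauss.-integrable setT (EFin \o (fun s : RR => F (z + (s : R) *: (r *: x)) - F z)).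
  have := gaussop_integrable z (r *: x) (bmeasD bF (bmeas_cst (- F z))).
  exact.
rewrite (_ : _ - _ = \int[gauss]_s (F (z + (s : R) *: (r *: x)) - F z)); last first.
  by have := gaussopDc (- F z) (r *: x) z bF; rewrite /gaussop => ->.
apply: (le_trans (le_normr_Rintegral measurableT iD)).
have -> : L * norm1 x * c1 * r = \int[gauss]_s (L * norm1 x * r * `|s : R|).
  rewrite RintegralZl//; [by ring|exact: gauss_integrable_norm].
apply: le_Rintegral => //; first exact: integrable_norm iD.
  by apply: (integrableZl measurableT (L * norm1 x * r) gauss_integrable_norm).
move=> s _; apply: (le_trans (FL _ _)); rewrite !norm1Z (ger0_norm r0).
by rewrite le_eqVlt; apply/orP; left; apply/eqP; ring.
Qed.

(** The first-order Taylor term has mean zero and the remainder is integrated against the third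
    absolute moment. [var] stays symbolic: it is a common factor of the two sides to be compared and
    enters through its sign. *)
Lemma gaussop_step (F : V -> R) p q (x : V) : smooth2 F p q ->
  exists2 C, 0 <= C & forall r z, 0 <= r ->
    `|gaussop (r *: x) F z - F z - 2^-1 * r ^+ 2 * var * quadr q x z| <= C * r ^+ 3.
Proof.
move=> sF; have [C C0 FC] := smooth2_taylor sF.
have [[bF bp bq] _] := sF.
exists (C * norm1 x ^+ 3 * c3).
  by rewrite !mulr_ge0 ?exprn_ge0 ?norm1_ge0// gauss_moment_ge0// => s; rewrite exprn_ge0.
move=> r z r0; set Q := quadr q x z.
pose A := \sum_k p k z * x k.
pose f (s : RR) := F (z + (s : R) *: (r *: x)) - F z - r * A * (s : R) - 2^-1 * r ^+ 2 * Q * (s : R) ^+ 2.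
have iF := gaussop_integrable z (r *: x) (bmeasD bF (bmeas_cst (- F z))).
have iA := integrableZl measurableT (r * A) (@gauss_integrable_id R).
have iQ := integrableZl measurableT (2^-1 * r ^+ 2 * Q) (@gauss_integrable_sqr R).
have i1 := integrableB measurableT iF iA.
have i2 := integrableB measurableT i1 iQ.
have iD : gauss.-integrable setT (EFin \o f) by exact: i2.
have -> : gaussop (r *: x) F z - F z - 2^-1 * r ^+ 2 * var * Q = \int[gauss]_s f s.
  rewrite /f (RintegralB (f1 := fun s : RR => F (z + (s : R) *: (r *: x)) - F z - r * A * (s : R))
    (f2 := fun s : RR => 2^-1 * r ^+ 2 * Q * (s : R) ^+ 2) measurableT i1 iQ).
  rewrite (RintegralB (f1 := fun s : RR => F (z + (s : R) *: (r *: x)) - F z)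
    (f2 := fun s : RR => r * A * (s : R)) measurableT iF iA).
  rewrite (RintegralZl _ measurableT (@gauss_integrable_id R)).
  rewrite (RintegralZl _ measurableT (@gauss_integrable_sqr R)).
  rewrite gauss_mean mulr0 subr0.
  have := gaussopDc (- F z) (r *: x) z bF; rewrite /gaussop => ->.
  by rewrite [X in _ - X]mulrAC.
apply: (le_trans (le_normr_Rintegral measurableT iD)).
have -> : C * norm1 x ^+ 3 * c3 * r ^+ 3 = \int[gauss]_s (C * norm1 x ^+ 3 * r ^+ 3 * `|s : R| ^+ 3).
  rewrite (RintegralZl _ measurableT (@gauss_integrable_cube R)); by ring.
apply: (le_Rintegral measurableT (integrable_norm iD)
  (integrableZl measurableT (C * norm1 x ^+ 3 * r ^+ 3) (@gauss_integrable_cube R))).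
move=> s _; have := FC z ((s : R) *: (r *: x)).
rewrite !norm1Z (ger0_norm r0).
rewrite (_ : \sum_k p k z * _ = r * A * (s : R)); last first.
  by rewrite /A mulr_sumr mulr_suml; apply: eq_bigr => k _; rewrite !ffunZE; ring.
rewrite (_ : \sum_k (\sum_l q k l z * _) * _ = r ^+ 2 * Q * (s : R) ^+ 2); last first.
  rewrite /Q /quadr mulr_sumr mulr_suml; apply: eq_bigr => k _.
  rewrite (_ : \sum_l q k l z * _ = s * r * \sum_l q k l z * x l); last first.
    by rewrite mulr_sumr; apply: eq_bigr => l _; rewrite !ffunZE; ring.
  by rewrite !ffunZE; ring.
have -> : F (z + s *: (r *: x)) - F z - r * A * s - 2^-1 * (r ^+ 2 * Q * s ^+ 2) = f s.
  by rewrite /f; congr (_ - _); ring.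
by move=> /le_trans; apply; rewrite le_eqVlt; apply/orP; left; apply/eqP; ring.
Qed.

End step.

(** * Gordon's comparison by Lindeberg replacement *)

Section comparison.
Context {R : realType} {K : finType}.
Local Notation V := {ffun K -> R}.
Local Notation gauss := (@normal_prob R 0 1).
Local Notation var := (\int[gauss]_s (s : R) ^+ 2).

(** The covariance of the Gaussian vector obtained by summing the [x] in [xs] with independent
    standard normal weights. *)
Definition cov (xs : seq V) (k l : K) : R := \sum_(x <- xs) x k * x l.

Lemma lipschitz1D (F G : V -> R) : lipschitz1 F -> lipschitz1 G ->
  lipschitz1 (fun z => F z + G z).
Proof.
move=> [L L0 FL] [M M0 GM]; exists (L + M); first exact: addr_ge0.
move=> z u; rewrite opprD addrACA mulrDl.
by rewrite (le_trans (ler_normD _ _))// lerD.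
Qed.

Lemma lipschitz1_cst c : lipschitz1 (fun _ : V => c).
Proof. by exists 0 => // z u; rewrite subrr normr0 mul0r. Qed.

Lemma lipschitz1_sum (I : Type) (r : seq I) (F : I -> V -> R) :
  (forall i, lipschitz1 (F i)) -> lipschitz1 (fun z => \sum_(i <- r) F i z).
Proof.
move=> FL; elim: r => [|i r IH].
  rewrite (_ : (fun _ => _) = fun=> 0); first exact: lipschitz1_cst.
  by apply/funext => z; rewrite big_nil.
rewrite (_ : (fun _ => _) = fun z => F i z + \sum_(i <- r) F i z).
  exact: lipschitz1D.
by apply/funext => z; rewrite big_cons.
Qed.

Lemma lipschitz1Zr c (F : V -> R) : lipschitz1 F -> lipschitz1 (fun z => F z * c).
Proof.
move=> [L L0 FL]; exists (L * `|c|); first by rewrite mulr_ge0.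
by move=> z u; rewrite -mulrBl normrM mulrAC ler_wpM2r.
Qed.

Lemma bmeasZr c (F : V -> R) : bmeas F -> bmeas (fun z => F z * c).
Proof. by move=> bF; exact: (bmeasM bF (bmeas_cst c)). Qed.

Lemma bmeas_quadr q (x : V) : (forall k l, bmeas (q k l)) -> bmeas (quadr q x).
Proof.
move=> bq; apply: bmeas_sum => k; apply: bmeasZr; apply: bmeas_sum => l.
exact: bmeasZr.
Qed.

Lemma lipschitz1_quadr q (x : V) : (forall k l, lipschitz1 (q k l)) -> lipschitz1 (quadr q x).
Proof.
move=> bq; apply: lipschitz1_sum => k; apply: lipschitz1Zr; apply: lipschitz1_sum => l.
exact: lipschitz1Zr.
Qed.

(** Second-order terms add up along the list: averaging along one more direction changes the
    Lipschitz sum of Hessian forms by O(r), and that sum carries a factor r^2. *)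
Lemma gaussops_step (F : V -> R) p q (xs : seq V) : smooth2 F p q ->
  exists2 C, 0 <= C & forall r z, 0 <= r <= 1 ->
    `|gaussops [seq r *: x | x <- xs] F z - F z
      - 2^-1 * r ^+ 2 * var * \sum_(x <- xs) quadr q x z| <= C * r ^+ 3.
Proof.
move=> sF; have [[bF bp bq] [_ _ lq]] := sF.
elim: xs => [|x xs [C C0 IH]].
  exists 0 => // r z _; by rewrite big_nil /= subrr mulr0 subr0 normr0 mul0r.
have [D D0 HD] := gaussop_step x sF.
pose S z := \sum_(x <- xs) quadr q x z.
have bS : bmeas S by apply: bmeas_sum => y; exact: bmeas_quadr.
have lS : lipschitz1 S by apply: lipschitz1_sum => y; exact: lipschitz1_quadr.
have [E E0 HE] := gaussop_lip x bS lS.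
have var0 : 0 <= var by apply: gauss_moment_ge0 => s; exact: sqr_ge0.
exists (C + D + 2^-1 * var * E); first by rewrite !addr_ge0// !mulr_ge0.
move=> r z /andP[r0 r1].
pose c := 2^-1 * r ^+ 2 * var.
have c0 : 0 <= c by rewrite !mulr_ge0// sqr_ge0.
set T := gaussops [seq r *: x | x <- xs] F.
have bT : bmeas T by exact: bmeas_gaussops.
(* [B] is the error in the induction hypothesis; averaging it along one more direction preserves its
   bound. *)
pose B y := T y + (- 1) * F y + (- c) * S y.
have bmF : bmeas (fun y => (-1) * F y) by exact: (bmeasM (bmeas_cst _) bF).
have bcS : bmeas (fun y => (- c) * S y) by exact: (bmeasM (bmeas_cst _) bS).
have bTF := bmeasD bT bmF.
have bB : bmeas B by exact: (bmeasD bTF bcS).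
have HB : `|gaussop (r *: x) B z| <= C * r ^+ 3.
  apply: gaussop_norm_le => // y; rewrite /B mulN1r mulNr; apply: IH.
  by rewrite r0.
have e : gaussop (r *: x) B z = gaussop (r *: x) T z - gaussop (r *: x) F z - c * gaussop (r *: x) S z.
  rewrite /B (gaussopD _ _ bTF bcS) (gaussopD _ _ bT bmF).
  by rewrite (gaussopZ _ _ _ bF) (gaussopZ _ _ _ bS) mulN1r mulNr.
rewrite /= big_cons -/(S z) -/T -/c.
have -> : gaussop (r *: x) T z - F z - c * (quadr q x z + S z) =
   gaussop (r *: x) B z + (gaussop (r *: x) F z - F z - c * quadr q x z) +
   c * (gaussop (r *: x) S z - S z) by rewrite e; ring.
rewrite (le_trans (ler_normD _ _))// !mulrDl; apply: lerD.
  by rewrite (le_trans (ler_normD _ _))// lerD// HD.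
rewrite normrM (ger0_norm c0); apply: (le_trans (ler_wpM2l c0 (HE r z r0))).
by rewrite le_eqVlt; apply/orP; left; apply/eqP; rewrite /c; ring.
Qed.

Lemma sum_quadr q (xs : seq V) z :
  \sum_(x <- xs) quadr q x z = \sum_k \sum_l q k l z * cov xs k l.
Proof.
rewrite exchange_big; apply: eq_bigr => k _ /=.
under eq_bigr do rewrite mulr_suml.
rewrite exchange_big; apply: eq_bigr => l _ /=.
rewrite /cov mulr_sumr; apply: eq_bigr => x _; ring.
Qed.

(** The averages commute, so all those along [x] can be gathered in front; each direction is then
    recombined separately. *)
Lemma iter_gaussops_cons n (x : V) xs (F : V -> R) : bmeas F ->
  iter n (gaussops (x :: xs)) F = iter n (gaussop x) (iter n (gaussops xs) F).
Proof.
move=> bF.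
have bI m : bmeas (iter m (gaussops xs) F).
  by elim: m => //= m IH; exact: bmeas_gaussops.
have cI m G : bmeas G -> gaussops xs (iter m (gaussop x) G) = iter m (gaussop x) (gaussops xs G).
  move=> bG; elim: m => //= m IH.
  rewrite -IH -gaussop_gaussops//; elim: m {IH} => //= m IH; exact: bmeas_gaussop.
by elim: n => //= n ->; rewrite cI.
Qed.

Lemma iter_gaussop n (r : R) (x : V) (F : V -> R) : bmeas F -> 0 < r ->
  iter n.+1 (gaussop (r *: x)) F = gaussop ((Num.sqrt n.+1%:R * r) *: x) F.
Proof.
move=> bF r0; elim: n => [|n IH]; first by rewrite /= sqrtr1 mul1r.
rewrite iterS IH; set c := Num.sqrt n.+2%:R.
have c0 : 0 < c by rewrite sqrtr_gt0.
(* In the unit [(c * r) *: x] the two steps have coefficients with squares (n+1)/(n+2) and 1/(n+2),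
   which sum to 1 as [gaussop_add] demands. *)
have e : forall t, (t * r) *: x = (t / c) *: ((c * r) *: x).
  by move=> t; rewrite scalerA; congr (_ *: _); field; rewrite gt_eqF.
rewrite (e (Num.sqrt n.+1%:R)) -{1}[r]mul1r (e 1) gaussop_add//.
  rewrite !expr_div_n expr1n !sqr_sqrtr ?ler0n//.
  by rewrite addrC -mulrDl natr1 mulfV// pnatr_eq0.
by rewrite divr_gt0// sqrtr_gt0.
Qed.

Lemma iter_gaussops_sqrt n (xs : seq V) (F : V -> R) : bmeas F ->
  iter n.+1 (gaussops [seq (Num.sqrt n.+1%:R)^-1 *: x | x <- xs]) F = gaussops xs F.
Proof.
move=> bF; elim: xs => [|x xs IH].
  by rewrite /=; elim: n => //= n ->.
rewrite [map _ _]/= iter_gaussops_cons// IH.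
have s0 : 0 < Num.sqrt n.+1%:R :> R by rewrite sqrtr_gt0.
rewrite iter_gaussop ?invr_gt0//; last exact: bmeas_gaussops.
by rewrite mulfV ?gt_eqF// scale1r.
Qed.

(* Lindeberg's replacement argument: each of the n factors of size 1/sqrt n
   contributes an error O(n^(-3/2)). *)
Lemma gaussops_le_of_cov (F : V -> R) p q (xs ys : seq V) (z : V) :
  smooth2 F p q ->
  (forall z k l, q k l z * cov xs k l <= q k l z * cov ys k l) ->
  gaussops xs F z <= gaussops ys F z.
Proof.
move=> sF qcov; have [[bF _ _] _] := sF.
have [C C0 HC] := gaussops_step xs sF.
have [D D0 HD] := gaussops_step ys sF.
have var0 : 0 <= var by apply: gauss_moment_ge0 => s; exact: sqr_ge0.
have one (r : R) y : 0 <= r <= 1 -> gaussops [seq r *: x | x <- xs] F y <=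
    gaussops [seq r *: x | x <- ys] F y + (C + D) * r ^+ 3.
  move=> r01; have := HC r y r01; have := HD r y r01.
  rewrite !sum_quadr.
  have : 2^-1 * r ^+ 2 * var * (\sum_k \sum_l q k l y * cov xs k l) <=
         2^-1 * r ^+ 2 * var * (\sum_k \sum_l q k l y * cov ys k l).
    apply: ler_wpM2l; first by case/andP: r01 => r0 _; rewrite !mulr_ge0.
    by apply: ler_sum => k _; apply: ler_sum => l _.
  rewrite !ler_norml => h /andP[h1 h2] /andP[h3 h4].
  by rewrite mulrDl; lra.
(* Each replacement costs (C + D) r^3. The costs simply add, since the averages are monotone,
   commute, and let constants pass through. *)
have many (r : R) m y : 0 <= r <= 1 ->
    iter m (gaussops [seq r *: x | x <- xs]) F y <=
    iter m (gaussops [seq r *: x | x <- ys]) F y + m%:R * ((C + D) * r ^+ 3).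
  move=> r01; set T := gaussops _; set S := gaussops _.
  set c := (C + D) * r ^+ 3.
  have bT j G : bmeas G -> bmeas (iter j T G).
    by move=> bG; elim: j => //= j IH; exact: bmeas_gaussops.
  have bS j G : bmeas G -> bmeas (iter j S G).
    by move=> bG; elim: j => //= j IH; exact: bmeas_gaussops.
  have TS j G : bmeas G -> iter j T (S G) = S (iter j T G).
    by move=> bG; elim: j => //= j ->; rewrite /T /S gaussopsC//; exact: bT.
  have leT j G H : bmeas G -> bmeas H -> (forall z, G z <= H z) ->
      forall z, iter j T G z <= iter j T H z.
    move=> bG bH GH; elim: j => //= j IH; apply: le_gaussops => //; exact: bT.
  have Tc j G e : bmeas G -> iter j T (fun z => G z + e) = fun z => iter j T G z + e.
    move=> bG; elim: j => //= j ->; apply/funext => w.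
    by rewrite /T gaussopsDc//; exact: bT.
  elim: m y => [|m IH] y; first by rewrite /= mul0r addr0.
  have bSF : bmeas (S F) by exact: (bS 1%N).
  rewrite iterSr.
  apply: (@le_trans _ _ (iter m T (fun z => S F z + c) y)).
    apply: leT => //; [exact: (bT 1%N)|exact: bmeasD bSF (bmeas_cst c)|].
    by move=> w; exact: (one r).
  rewrite Tc// TS// -[m.+1%:R]natr1 mulrDl mul1r addrA lerD2r.
  rewrite /= -gaussopsDc; last exact: bS.
  apply: le_gaussops; [exact: bT|exact: bmeasD (bS m _ bF) (bmeas_cst _)|exact: IH].
apply/ler_addgt0Pr => e e0.
(* The total error is (n+1) (C + D) (n+1)^(-3/2); this [n] makes the square root of n+1 at least (C
   + D)/e. *)
pose n := Num.truncn (((C + D) / e) ^+ 2).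
have s0 : 0 < Num.sqrt n.+1%:R :> R by rewrite sqrtr_gt0.
set s := Num.sqrt n.+1%:R in s0.
have s1 : 1 <= s by rewrite -sqrtr1 ler_sqrt// ler1n.
have r01 : 0 <= s^-1 <= 1 by rewrite invr_ge0 ltW//= invf_le1.
have := many s^-1 n.+1 z r01.
rewrite !iter_gaussops_sqrt//; move=> /le_trans; apply; rewrite lerD2l.
have CD0 : 0 <= C + D by exact: addr_ge0.
have -> : n.+1%:R = s ^+ 2 by rewrite sqr_sqrtr.
have -> : s ^+ 2 * ((C + D) * s^-1 ^+ 3) = (C + D) / s by field; rewrite gt_eqF.
rewrite ler_pdivrMr// mulrC -ler_pdivrMr//.
rewrite -(ger0_norm (divr_ge0 CD0 (ltW e0))) -sqrtr_sqr ler_sqrt//.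
by rewrite ltW// truncnS_gt.
Qed.

End comparison.

(** * The smooth min-max indicator *)

Section smooth_product.
Context {R : realType} {K : finType}.
Local Notation V := {ffun K -> R}.

Lemma scaleRE (a b : R) : a *: b = a * b. Proof. by []. Qed.

Lemma lipschitz1M (F G : V -> R) : bmeas F -> bmeas G ->
  lipschitz1 F -> lipschitz1 G -> lipschitz1 (fun z => F z * G z).
Proof.
move=> [_ [M FM]] [_ [N GN]] [L L0 FL] [L' L'0 GL].
exists (`|M| * L' + `|N| * L); first by rewrite addr_ge0// mulr_ge0.
move=> z u.
rewrite (_ : _ - _ = F (z + u) * (G (z + u) - G z) + G z * (F (z + u) - F z)); last by ring.
rewrite (le_trans (ler_normD _ _))// !normrM mulrDl -!mulrA lerD// ler_pM//.
  exact: le_trans (FM _) (ler_norm _).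
exact: le_trans (GN _) (ler_norm _).
Qed.

Lemma eq_line_derivable (F G : V -> R) p p' : F =1 G -> (forall k, p k =1 p' k) ->
  line_derivable F p -> line_derivable G p'.
Proof.
move=> /funext -> pp'; rewrite (_ : p' = p)//.
by apply/funext => k; apply/funext => z; rewrite pp'.
Qed.

Lemma line_derivable_cst c : line_derivable (fun _ : V => c) (fun _ _ => 0).
Proof.
move=> z u s; apply: is_derive_eq.
by rewrite big1// => k _; rewrite mul0r.
Qed.

Lemma line_derivableD (F G : V -> R) p p' : line_derivable F p -> line_derivable G p' ->
  line_derivable (fun z => F z + G z) (fun k z => p k z + p' k z).
Proof.
move=> Fp Gp z u s; have h1 := Fp z u s; have h2 := Gp z u s.
apply: is_derive_eq; rewrite -big_split/=; apply: eq_bigr => k _.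
by rewrite mulrDl.
Qed.

Lemma line_derivableM (F G : V -> R) p p' : line_derivable F p -> line_derivable G p' ->
  line_derivable (fun z => F z * G z) (fun k z => F z * p' k z + p k z * G z).
Proof.
move=> Fp Gp z u s; have h1 := Fp z u s; have h2 := Gp z u s.
apply: is_derive_eq; rewrite !scaleRE !mulr_sumr -big_split/=.
by apply: eq_bigr => k _; ring.
Qed.

Lemma line_derivableZ c (F : V -> R) p : line_derivable F p ->
  line_derivable (fun z => c * F z) (fun k z => c * p k z).
Proof.
move=> Fp z u s; have h1 := Fp z u s.
apply: is_derive_eq; rewrite ?scaler0 ?addr0 !scaleRE mulr_sumr.
by apply: eq_bigr => k _; rewrite mulrA.
Qed.

Lemma smooth2_cst c : smooth2 (fun _ : V => c) (fun _ _ => 0) (fun _ _ _ => 0).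
Proof.
split; split; do ?[by move=> *; exact: bmeas_cst | by move=> *; exact: line_derivable_cst].
by move=> *; exact: lipschitz1_cst.
Qed.

Lemma smooth2_onem (F : V -> R) p q : smooth2 F p q ->
  smooth2 (fun z => 1 - F z) (fun k z => - p k z) (fun k l z => - q k l z).
Proof.
have bN (G : V -> R) : bmeas G -> bmeas (fun z => - G z).
  move=> bG; have := bmeasM (bmeas_cst (-1)) bG.
  by rewrite (_ : (fun _ => _) = fun z => - G z)//; apply/funext => z; rewrite mulN1r.
have lN (G : V -> R) : lipschitz1 G -> lipschitz1 (fun z => - G z).
  move=> lG; have := lipschitz1Zr (-1) lG.
  by rewrite (_ : (fun _ => _) = fun z => - G z)//; apply/funext => z; rewrite mulrN1.
have dN (G : V -> R) p' : line_derivable G p' -> line_derivable (fun z => - G z) (fun k z => - p' k z).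
  by move/(line_derivableZ (-1)); apply: eq_line_derivable => [z|k z]; rewrite mulN1r.
move=> [[bF bp bq] [Fp pq lq]]; split; split.
- exact: bmeasD (bmeas_cst 1) (bN _ bF).
- by move=> k; exact: bN.
- by move=> k l; exact: bN.
- apply: eq_line_derivable (line_derivableD (line_derivable_cst 1) (dN _ _ Fp)) => // k z.
  exact: add0r.
- by move=> k; exact: dN.
- by move=> k l; exact: lN.
Qed.

Lemma smooth2M (F G : V -> R) p q p' q' : smooth2 F p q -> smooth2 G p' q' ->
  smooth2 (fun z => F z * G z) (fun k z => F z * p' k z + p k z * G z)
   (fun k l z => (F z * q' k l z + p l z * p' k z) + (p k z * p' l z + q k l z * G z)).
Proof.
move=> [[bF bp bq] [Fp pq lq]] [[bG bp' bq'] [Gp' pq' lq']].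
have lF := line_derivable_lipschitz Fp bp.
have lG := line_derivable_lipschitz Gp' bp'.
have lp k := line_derivable_lipschitz (pq k) (bq k).
have lp' k := line_derivable_lipschitz (pq' k) (bq' k).
split; split.
- exact: bmeasM.
- by move=> k; apply: bmeasD; exact: bmeasM.
- by move=> k l; apply: bmeasD; apply: bmeasD; exact: bmeasM.
- exact: line_derivableM.
- by move=> k; apply: line_derivableD; exact: line_derivableM.
- by move=> k l; apply: lipschitz1D; apply: lipschitz1D; exact: lipschitz1M.
Qed.

(** The decreasing logistic function, close to 1 far to the left: a product of its values over a row
    is a smooth indicator that all entries of the row are negative. *)
Definition sigmoid (x : R) : R := (1 + expR x)^-1.

Lemma sigmoid_ge0 x : 0 <= sigmoid x.
Proof. by rewrite invr_ge0 addr_ge0// expR_ge0. Qed.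

Lemma sigmoid_le1 x : sigmoid x <= 1.
Proof. by rewrite invf_le1 ?ltr_wpDr ?expR_ge0// lerDl expR_ge0. Qed.

Lemma sigmoid_le_expRN x : sigmoid x <= expR (- x).
Proof. by rewrite expRN lef_pV2 ?posrE ?expR_gt0 ?ltr_wpDr ?expR_ge0// lerDr. Qed.

Lemma sigmoid_ge_onem_expR x : 1 - expR x <= sigmoid x.
Proof.
have e0 := expR_ge0 x; rewrite /sigmoid -[leRHS]mul1r ler_pdivlMr; last lra.
by have := sqr_ge0 (expR x); nra.
Qed.

Lemma sigmoid_antitone x y : x <= y -> sigmoid y <= sigmoid x.
Proof.
by move=> xy; rewrite lef_pV2 ?posrE ?ltr_wpDr ?expR_ge0// lerD2l ler_expR.
Qed.

Lemma is_derive_sigmoid_line (a b s : R) :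
  is_derive s (1 : R) (fun s => sigmoid (a + s * b))
    (- (sigmoid (a + s * b) * (1 - sigmoid (a + s * b))) * b).
Proof.
have e0 : 1 + expR (a + s * b) != 0 by rewrite gt_eqF// ltr_wpDr ?expR_ge0.
have h : is_derive s (1 : R) (fun s => 1 + expR (a + s * b)) (expR (a + s * b) * b).
  apply: is_derive_eq.
  by rewrite !add0r scaler0 add0r !mul1r -[b%:A]/(b * 1) mulr1.
have := @is_deriveV _ (fun s => 1 + expR (a + s * b)) s _ _ e0 h.
rewrite scaleRE (_ : - _ * _ = - (sigmoid (a + s * b) * (1 - sigmoid (a + s * b))) * b)//.
by rewrite /sigmoid; field.
Qed.

Lemma measurable_sigmoid : measurable_fun setT sigmoid.
Proof.
apply: continuous_measurable_fun => x.
apply: cvgV; first by rewrite gt_eqF// ltr_wpDr ?expR_ge0.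
by apply: cvgD; [exact: cvg_cst|exact: continuous_expR].
Qed.

(** Since the derivative is - sigmoid (1 - sigmoid), all derivatives are polynomials in [sigmoid],
    and their bounds and Lipschitz constants follow from those of [sigmoid]. *)
Lemma smooth2_sigmoid (k0 : K) :
  smooth2 (fun z : V => sigmoid (z k0))
    (fun k z => (k == k0)%:R * (- 1 * (sigmoid (z k0) * (1 - sigmoid (z k0)))))
    (fun k l z => (k == k0)%:R * ((l == k0)%:R *
       (sigmoid (z k0) * (1 - sigmoid (z k0)) * (1 - 2 * sigmoid (z k0))))).
Proof.
pose S (z : V) := sigmoid (z k0).
have sumk0 (a : R) (u : V) : \sum_k (k == k0)%:R * a * u k = a * u k0.
  rewrite (bigD1 k0)//= eqxx mul1r big1 ?addr0// => k /negbTE ->.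
  by rewrite !mul0r.
have bS : bmeas S.
  split; first by move=> d T z mz; exact: (measurableT_comp measurable_sigmoid (mz k0)).
  by exists 1 => z; rewrite ger0_norm ?sigmoid_ge0// sigmoid_le1.
have b1S : bmeas (fun z => 1 - S z).
  have := bmeasD (bmeas_cst 1) (bmeasZr (-1) bS).
  by rewrite (_ : (fun _ => _) = fun z => 1 - S z)//; apply/funext => z; rewrite mulrN1.
have b2S : bmeas (fun z => 1 - 2 * S z).
  have := bmeasD (bmeas_cst 1) (bmeasZr (-2) bS).
  rewrite (_ : (fun _ => _) = fun z => 1 - 2 * S z)//; apply/funext => z.
  by rewrite mulrN mulrC.
have bp k : bmeas (fun z : V => (k == k0)%:R * (-1 * (S z * (1 - S z)))).
  by do 2 (apply: bmeasM; first exact: bmeas_cst); exact: bmeasM.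
have Sd : line_derivable S (fun k z => (k == k0)%:R * (-1 * (S z * (1 - S z)))).
  move=> z u s; rewrite sumk0 mulN1r.
  have -> : (fun s : R => S (z + s *: u)) = (fun s => sigmoid (z k0 + s * u k0)).
    by apply/funext => t; rewrite /S !ffunE.
  have -> : S (z + s *: u) = sigmoid (z k0 + s * u k0) by rewrite /S !ffunE.
  exact: is_derive_sigmoid_line.
have lS := line_derivable_lipschitz Sd bp.
have l1S : lipschitz1 (fun z => 1 - S z).
  have := lipschitz1D (lipschitz1_cst 1) (lipschitz1Zr (-1) lS).
  by rewrite (_ : (fun _ => _) = fun z => 1 - S z)//; apply/funext => z; rewrite mulrN1.
have l2S : lipschitz1 (fun z => 1 - 2 * S z).
  have := lipschitz1D (lipschitz1_cst 1) (lipschitz1Zr (-2) lS).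
  rewrite (_ : (fun _ => _) = fun z => 1 - 2 * S z)//; apply/funext => z.
  by rewrite mulrN mulrC.
split; split => //.
- by move=> k l; do 2 (apply: bmeasM; first exact: bmeas_cst); do 2 apply: bmeasM => //.
- move=> k.
  have D1 : line_derivable (fun z => 1 - S z)
      (fun k z => 0 + -1 * ((k == k0)%:R * (-1 * (S z * (1 - S z))))).
    apply: eq_line_derivable (line_derivableD (line_derivable_cst 1) (line_derivableZ (-1) Sd)) => // z.
    by rewrite mulN1r.
  apply: eq_line_derivable (line_derivableZ (k == k0)%:R
    (line_derivableZ (-1) (line_derivableM Sd D1))) => // l z.
  by rewrite /S; ring.
- move=> k l; have bc c := @bmeas_cst R K c; have lc c := @lipschitz1_cst R K c.
  have bSS := bmeasM bS b1S; have lSS := lipschitz1M bS b1S lS l1S.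
  have bSSS := bmeasM bSS b2S; have lSSS := lipschitz1M bSS b2S lSS l2S.
  apply: lipschitz1M => //; first by apply: bmeasM.
  by apply: lipschitz1M.
Qed.

End smooth_product.

Section testfun.
Context {R : realType} {I J : finType}.
Local Notation V := {ffun I * J -> R}.

(** A smooth version of the indicator that min_i max_j z(i, j) is negative. *)
Definition testfun (z : V) : R :=
  1 - \prod_(i : I) (1 - \prod_(j : J) sigmoid (z (i, j))).

(** The factor for row [i] sees only the coordinates of that row and decreases in each. Second
    derivatives within the row have no definite sign, and none is claimed. *)
Lemma block_smooth2 (i : I) (r : seq J) : exists p q,
  [/\ smooth2 (fun z : V => \prod_(j <- r) sigmoid (z (i, j))) p q,
      (forall k z, p k z <= 0), (forall k z, k.1 != i -> p k z = 0) &
      (forall k l z, k.1 != l.1 -> q k l z = 0)].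
Proof.
elim: r => [|j r [p [q [s2 p0 pi qi]]]].
  exists (fun _ _ => 0), (fun _ _ _ => 0); split => //.
  rewrite (_ : (fun _ => _) = fun=> 1); first exact: smooth2_cst.
  by apply/funext => z; rewrite big_nil.
have sj := @smooth2_sigmoid R _ (i, j).
have := smooth2M sj s2; set P := (fun k z => _ + _); set Q := (fun k l z => _ + _ + _).
move=> s3; exists P, Q.
have offi (k : I * J) : k.1 != i -> (k == (i, j)) = false.
  by move=> ki; apply/eqP => e; move: ki; rewrite e eqxx.
split.
- rewrite (_ : (fun _ => _) = fun z : V => sigmoid (z (i, j)) * \prod_(j <- r) sigmoid (z (i, j)))//.
  by apply/funext => z; rewrite big_cons.
- move=> k z; rewrite /P.
  have h : 0 <= \prod_(j <- r) sigmoid (z (i, j)) by apply: prodr_ge0 => j' _; exact: sigmoid_ge0.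
  have h1 := sigmoid_ge0 (z (i, j)); have h2 := sigmoid_le1 (z (i, j)).
  rewrite -oppr_ge0 opprD addr_ge0//.
    by rewrite -mulrN mulr_ge0// oppr_ge0.
  by rewrite mulN1r mulrN mulNr opprK !mulr_ge0// subr_ge0.
- by move=> k z ki; rewrite /P (pi _ _ ki) offi// !mul0r mulr0 addr0.
- move=> k l z kl; rewrite /Q (qi _ _ _ kl).
  have [ki|ki] := eqVneq k.1 i.
    have li : l.1 != i by rewrite -ki eq_sym.
    by rewrite (offi _ li) (pi _ _ li) !(mul0r, mulr0) !addr0.
  by rewrite (offi _ ki) (pi _ _ ki) !(mul0r, mulr0) !addr0.
Qed.

Lemma prod_sigmoid_ge0 (z : V) i : 0 <= \prod_(j : J) sigmoid (z (i, j)).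
Proof. by apply: prodr_ge0 => j _; exact: sigmoid_ge0. Qed.

Lemma prod_sigmoid_le1 (z : V) i : \prod_(j : J) sigmoid (z (i, j)) <= 1.
Proof. by apply: prodr_ile1 => j _; rewrite sigmoid_ge0 sigmoid_le1. Qed.

(** In the Leibniz formula for the product over rows, a factor's own mixed derivative across two
    rows vanishes, and the remaining terms are products of nonnegative quantities. Subtracting from
    1 reverses the sign. *)
Lemma testfun_smooth2 : exists p q,
  smooth2 testfun p q /\ (forall k l z, k.1 != l.1 -> q k l z <= 0).
Proof.
suff [p [q [s2 p0 q0]]] : exists p q,
  [/\ smooth2 (fun z : V => \prod_(i <- index_enum I) (1 - \prod_(j : J) sigmoid (z (i, j)))) p q,
      (forall k z, 0 <= p k z) &
      (forall k l z, k.1 != l.1 -> 0 <= q k l z)].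
  eexists; eexists; split; first exact: (smooth2_onem s2).
  by move=> k l z kl /=; rewrite oppr_le0 q0.
elim: (index_enum I) => [|i r [p [q [s2 p0 qi]]]].
  exists (fun _ _ => 0), (fun _ _ _ => 0); split => //.
  rewrite (_ : (fun _ => _) = fun=> 1); first exact: smooth2_cst.
  by apply/funext => z; rewrite big_nil.
have [p' [q' [s' p'0 _ q'0]]] := block_smooth2 i (index_enum J).
have := smooth2M (smooth2_onem s') s2.
set P := (fun k z => _ + _); set Q := (fun k l z => _ + _ + _).
move=> s3; exists P, Q; split.
- rewrite (_ : (fun _ => _) = fun z : V => (1 - \prod_(j : J) sigmoid (z (i, j))) *
     \prod_(i <- r) (1 - \prod_(j : J) sigmoid (z (i, j))))//.
  by apply/funext => z; rewrite big_cons.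
- move=> k z; rewrite /P addr_ge0// mulr_ge0 ?subr_ge0 ?prod_sigmoid_le1 ?oppr_ge0//.
  by apply: prodr_ge0 => i' _; rewrite subr_ge0 prod_sigmoid_le1.
- move=> k l z kl; rewrite /Q (q'0 _ _ _ kl) oppr0 mul0r addr0.
  rewrite !addr_ge0// mulr_ge0 ?subr_ge0 ?prod_sigmoid_le1 ?oppr_ge0//.
  exact: qi.
Qed.

(** The union bound for independent events of probabilities [b i]. *)
Lemma onem_prod_onem_le_sum (U : finType) (b : U -> R) : (forall i, 0 <= b i <= 1) ->
  1 - \prod_i (1 - b i) <= \sum_i b i.
Proof.
move=> b01; elim: (index_enum U) => [|i r IH]; first by rewrite !big_nil subrr.
rewrite !big_cons; case/andP: (b01 i) => b0 b1.
have : 0 <= \prod_(j <- r) (1 - b j) <= 1.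
  rewrite prodr_ge0 => [|j _]; last by rewrite subr_ge0; case/andP: (b01 j).
  apply: prodr_ile1 => j _; rewrite subr_ge0 lerBlDr lerDl.
  by case/andP: (b01 j) => -> ->.
move: IH; set x := \prod_(j <- r) _; set y := \sum_(j <- r) _ => IH /andP[x0 x1].
nra.
Qed.

Lemma testfun_itv z : 0 <= testfun z <= 1.
Proof.
have h : 0 <= \prod_(i : I) (1 - \prod_(j : J) sigmoid (z (i, j))) <= 1.
  rewrite prodr_ge0 => [|i _]; last by rewrite subr_ge0 prod_sigmoid_le1.
  by apply: prodr_ile1 => i _; rewrite subr_ge0 prod_sigmoid_le1 lerBlDr lerDl prod_sigmoid_ge0.
by rewrite /testfun; case/andP: h => h0 h1; rewrite subr_ge0 h1 lerBlDr lerDl.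
Qed.

Lemma testfun_antitone (z z' : V) : (forall k, z k <= z' k) -> testfun z' <= testfun z.
Proof.
move=> zz'; rewrite lerD2l lerN2; apply: ler_prod => i _.
rewrite subr_ge0 prod_sigmoid_le1/= lerD2l lerN2; apply: ler_prod => j _.
by rewrite sigmoid_ge0 sigmoid_antitone.
Qed.

Lemma testfun_ge (z : V) (a : R) : (exists i, forall j, z (i, j) <= - a) ->
  1 - #|J|%:R * expR (- a) <= testfun z.
Proof.
move=> [i zi]; rewrite lerD2l lerN2.
apply: (@le_trans _ _ (1 - \prod_(j : J) sigmoid (z (i, j)))).
  rewrite (bigD1 i)//= ler_piMr ?subr_ge0 ?prod_sigmoid_le1//.
  by apply: prodr_ile1 => i' _; rewrite subr_ge0 prod_sigmoid_le1 lerBlDr lerDl prod_sigmoid_ge0.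
have := @onem_prod_onem_le_sum J (fun j => 1 - sigmoid (z (i, j))).
under [\prod_j _]eq_bigr do rewrite subKr.
move=> /(_ _)/le_trans; apply.
  by move=> j; rewrite subr_ge0 sigmoid_le1 lerBlDr lerDl sigmoid_ge0.
apply: (@le_trans _ _ (\sum_(j : J) expR (- a))); last by rewrite sumr_const mulr_natl.
apply: ler_sum => j _; rewrite lerBlDr -lerBlDl.
apply: le_trans (sigmoid_ge_onem_expR _); rewrite lerD2l lerN2 ler_expR; exact: zi.
Qed.

Lemma testfun_le (z : V) (a : R) : (forall i, exists j, a <= z (i, j)) ->
  testfun z <= #|I|%:R * expR (- a).
Proof.
move=> zi; apply: (@le_trans _ _ (\sum_(i : I) \prod_(j : J) sigmoid (z (i, j)))).
  by apply: onem_prod_onem_le_sum => i; rewrite prod_sigmoid_ge0 prod_sigmoid_le1.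
apply: (@le_trans _ _ (\sum_(i : I) expR (- a))); last by rewrite sumr_const mulr_natl.
apply: ler_sum => i _; have [j aj] := zi i.
rewrite (bigD1 j)//= -[leRHS]mulr1; apply: ler_pM.
- exact: sigmoid_ge0.
- by apply: prodr_ge0 => j' _; exact: sigmoid_ge0.
- by apply: (le_trans (sigmoid_le_expRN _)); rewrite ler_expR lerN2.
- by apply: prodr_ile1 => j' _; rewrite sigmoid_ge0 sigmoid_le1.
Qed.

End testfun.

(** * Independence *)

Section law_of_iid_combination.
Context {dT : measure_display} {T : measurableType dT} {R : realType}.
Variables (P : probability T R) (I : finType) (X : I -> T -> R).
Hypothesis iidX : iid_std_normal P X.
Local Notation gauss := (@normal_prob R 0 1).
Local Notation RR := (measurableTypeR R).

Let mX i : measurable_fun setT (X i). Proof. by case: iidX. Qed.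

(* A pi-system generating the sigma-algebra of [(X i)_(i \in r)]. *)
Definition rectangles (r : seq I) : set (set T) :=
  [set Y | exists B : I -> set R, [/\ (forall i, measurable (B i)),
     (forall i, i \notin r -> B i = setT) &
     Y = \bigcap_(i in [set: I]) (X i @^-1` B i)]].

Lemma rectangles_measurable r Y : rectangles r Y -> measurable Y.
Proof.
move=> [B [mB _ ->]]; apply: fin_bigcap_measurable => //.
by move=> i _; rewrite -[X in measurable X]setTI; exact: mX.
Qed.

Lemma rectangles_setI r : setI_closed (rectangles r).
Proof.
move=> Y Z [B [mB Br ->]] [C [mC Cr ->]]; exists (fun i => B i `&` C i); split.
- by move=> i; exact: measurableI.
- by move=> i ir; rewrite Br// Cr// setIT.
- by rewrite -bigcapI; apply: eq_bigcapr => i _; rewrite preimage_setI.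
Qed.

Lemma rectanglesT r : rectangles r setT.
Proof.
exists (fun=> setT); split => //.
by apply/seteqP; split.
Qed.

Section peel.
Variables (a : I) (r : seq I).
Hypothesis ar : a \notin r.
(** The points of [T] with a coarser sigma-algebra: measurability on [T'] encodes dependence on the
    coordinates in [r] alone. *)
Let T' := g_sigma_algebraType (rectangles r).

Lemma measurable_to_rectangles : measurable_fun setT (id : T -> T').
Proof.
apply: (@measurability _ _ T T' setT id (rectangles r) erefl) => _ [Y rY <-].
by rewrite setTI; exact: rectangles_measurable rY.
Qed.

Lemma measurable_coord b : b \in r -> measurable_fun setT (X b : T' -> R).
Proof.
move=> br _ B mB; rewrite setTI; apply: sub_sigma_algebra.
exists (fun i => if i == b then B else setT); split.
- by move=> i; case: ifP.
- by move=> i ir; case: eqP => // ib; move: ir; rewrite ib br.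
- apply/seteqP; split => t /=.
    by move=> XB i _ /=; case: eqP => // ->.
  by move=> /(_ b Logic.I); rewrite /= eqxx.
Qed.

Let toT' : {mfun T >-> T'} :=
  HB.pack (id : T -> T') (isMeasurableFun.Build _ _ _ _ _ measurable_to_rectangles).
Let P' : probability T' R := distribution P toT'.

Lemma measurable_pair : measurable_fun setT (fun t : T => (X a t : RR, t : T')).
Proof. exact: (measurable_fun_pair (mX a) measurable_to_rectangles). Qed.

Let m' : {measure set (RR * T') -> \bar R} := image_measure P measurable_pair.

(** Both sides are finite measures in [Y] that agree on the pi-system of rectangles, hence on the
    sigma-algebra it generates. *)
Lemma indep_peel (A : set RR) (Y : set T') : measurable A -> measurable Y ->
  P ((X a @^-1` A) `&` Y) = (gauss A * P Y)%E.
Proof.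
move=> mA mY.
have mXA : measurable (X a @^-1` A) by rewrite -[X in measurable X]setTI; exact: mX.
have gA : (fine (gauss A))%:E = gauss A by rewrite fineK// fin_num_measure.
have gA0 : 0 <= fine (gauss A) by rewrite fine_ge0.
pose n1 : {measure set T' -> \bar R} :=
  image_measure (measure_function_mrestr__canonical__measure_function_Measure P mXA) measurable_to_rectangles.
pose n2 : {measure set T' -> \bar R} := mscale (NngNum gA0) P'.
have : n1 Y = n2 Y.
  apply: (@measure_unique _ R T' (rectangles r) (fun=> [set: T']) _ _ _ _ n1 n2) => //.
  - exact: rectangles_setI.
  - by move=> _; exact: rectanglesT.
  - by rewrite bigcup_const//; exists 0%N.
  - move=> _ [B [mB Br ->]].
    (* Because [a] is outside [r], the rectangle does not constrain coordinate [a], and [A] can be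
       inserted there; the product formula then factors. *)
    pose B' i := if i == a then A else B i.
    have mB' i : measurable (B' i) by rewrite /B'; case: ifP => _; [exact: mA|exact: mB].
    have [_ iid] := iidX.
    have -> : n1 (\bigcap_i X i @^-1` B i) = P (\bigcap_i X i @^-1` B' i).
      rewrite /n1 /image_measure/= /pushforward /mrestr; congr (P _).
      apply/seteqP; split => t /=.
        move=> [BX At] i _; rewrite /= /B'; case: eqP => [->//|_]; exact: BX.
      move=> B'X; split; last by have := B'X a Logic.I; rewrite /= /B' eqxx.
      move=> i _ /=; have := B'X i Logic.I; rewrite /= /B'; case: eqP => // -> _.
      by rewrite Br.
    have -> : n2 (\bigcap_i X i @^-1` B i) = (gauss A * P (\bigcap_i X i @^-1` B i))%E.
      by rewrite -[in RHS]gA.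
    rewrite !iid// (bigD1 a)//= [in RHS](bigD1 a)//= Br// probability_setT mul1e.
    rewrite {1}/B' eqxx; congr (_ * _)%E.
    by apply: eq_bigr => i ia; rewrite /B' (negbTE ia).
  - move=> _; rewrite /n1 /image_measure/= /pushforward /mrestr preimage_setT setTI.
    by rewrite (le_lt_trans (probability_le1 P mXA))// ltry.
move=> e; have e2 : n2 Y = (gauss A * P Y)%E by rewrite -[in RHS]gA.
rewrite -e2 -e /n1 /image_measure /= /pushforward /mrestr/= setIC//.
Qed.

(* [X a] is independent of the sigma-algebra generated by the other coordinates. *)
Lemma ge0_integral_peel (H : RR * T' -> \bar R) : measurable_fun setT H ->
  (forall p, 0 <= H p)%E ->
  (\int[P]_t H (X a t : RR, t : T') = \int[gauss]_s \int[P]_t H (s, t : T'))%E.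
Proof.
move=> mH H0.
transitivity (\int[m']_p H p)%E.
  by rewrite /m' /image_measure ge0_integral_pushforward//; exact: measurable_pair.
transitivity (\int[gauss \x P']_p H p)%E.
  apply: eq_measure_integral => Y mY _; apply/esym.
  apply: product_measure_unique => // A B mA mB.
  exact: indep_peel.
rewrite (fubini_tonelli1 (m1 := gauss) (m2 := P') H mH H0).
apply: eq_integral => s _; rewrite /fubini_F.
rewrite /P' ge0_integral_distribution//.
exact: (measurableT_comp mH (measurable_pair1 s)).
Qed.

End peel.

Context {K : finType}.
Local Notation V := {ffun K -> R}.

Lemma measurable_lin_comb (x : I -> V) (r : seq I) d (T' : measurableType d)
    (Z : I -> T' -> R) (z : T' -> V) :
  (forall i, i \in r -> measurable_fun setT (Z i)) ->
  (forall k, measurable_fun setT (fun t => z t k)) ->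
  forall k, measurable_fun setT (fun t => (z t + \sum_(i <- r) Z i t *: x i) k).
Proof.
elim: r z => [|a r IH] z mZ mz k.
  rewrite (_ : (fun _ => _) = fun t => z t k)//.
  by apply/funext => t; rewrite big_nil addr0.
rewrite (_ : (fun _ => _) = fun t => (z t + Z a t *: x a + \sum_(i <- r) Z i t *: x i) k); last first.
  by apply/funext => t; rewrite big_cons addrA.
apply: IH => [i ir|]; first by apply: mZ; rewrite inE ir orbT.
by apply: measurable_line => //; apply: mZ; rewrite inE eqxx.
Qed.

(** The link between the probability space and the averaging operators: coordinates are integrated
    out one at a time, [uniq r] keeping the one at the head outside the tail. *)
Lemma integral_lin_comb (x : I -> V) (F : V -> R) : bmeas F ->
  forall (r : seq I) (z : V), uniq r ->
  (\int[P]_t (F (z + \sum_(i <- r) X i t *: x i))%:E =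
    (gaussops [seq x i | i <- r] F z)%:E)%E.
Proof.
wlog F0 : F / forall z, 0 <= F z.
  move=> wF bF r z ur; have [mF [M FM]] := bF.
  have h0 z' : 0 <= F z' + M.
    by rewrite -lerBlDr sub0r; have := FM z'; rewrite ler_norml => /andP[].
  have bFM : bmeas (fun z => F z + M) by exact: bmeasD bF (bmeas_cst M).
  have := wF _ h0 bFM r z ur; rewrite gaussopsDc//.
  under eq_integral do rewrite EFinD.
  have mFz : measurable_fun setT (fun t => F (z + \sum_(i <- r) X i t *: x i)).
    by apply: (mF _ T (fun t => z + \sum_(i <- r) X i t *: x i)); exact: measurable_lin_comb.
  rewrite (integralD measurableT (bounded_integrable P mFz (fun t => FM _))
    (finite_measure_integrable_cst P M measurableT : P.-integrable setT (fun=> M%:E))).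
  rewrite (_ : \int[P]_t (M%:E) = M%:E)%E; last by rewrite integral_cst// -[RHS]mule1; congr (_ * _)%E; exact: probability_setT.
  rewrite EFinD => /(congr1 (fun e => e - M%:E)%E).
  by rewrite !addeK.
move=> bF; have [mF _] := bF; elim => [|a r IH] z.
  move=> _; under eq_integral do rewrite big_nil addr0.
  by rewrite integral_cst// -[RHS]mule1; congr (_ * _)%E; exact: probability_setT.
rewrite cons_uniq => /andP[ar ur] /=.
pose T' := g_sigma_algebraType (rectangles r).
pose H (p : RR * T') := (F (z + (p.1 : R) *: x a + \sum_(i <- r) X i p.2 *: x i))%:E.
have mH : measurable_fun setT H.
  apply/measurable_EFinP.
  apply: (mF _ (RR * T')%type (fun p => z + (p.1 : R) *: x a + \sum_(i <- r) X i p.2 *: x i)).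
  apply: (@measurable_lin_comb x r _ (RR * T')%type (fun i p => X i p.2) (fun p => z + (p.1 : R) *: x a)).
    by move=> i ir; exact: (measurableT_comp (measurable_coord ir) measurable_snd).
  by apply: (@measurable_line _ _ _ _ fst (fun=> z)) => //; exact: measurable_fst.
have H0 p : (0 <= H p)%E by rewrite lee_fin.
transitivity (\int[P]_t H (X a t : RR, t : T'))%E.
  by apply: eq_integral => t _; rewrite /H/= big_cons addrA.
rewrite (ge0_integral_peel ar mH H0) (gaussopE _ _ (bmeas_gaussops _ bF)).
by apply: eq_integral => s _; rewrite -(IH _ ur).
Qed.

End law_of_iid_combination.

(** * Discarding nonnegative Gaussian directions *)

Section half.
Context {R : realType} {K : finType}.
Local Notation V := {ffun K -> R}.
Local Notation gauss := (@normal_prob R 0 1).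
Local Notation RR := (measurableTypeR R).

Definition antitone (G : V -> R) := forall z z' : V, (forall k, z k <= z' k) -> G z' <= G z.

Lemma gaussopN (x : V) (G : V -> R) z : bmeas G -> (forall z, 0 <= G z) ->
  gaussop (- x) G z = gaussop x G z.
Proof.
move=> bG G0; apply: EFin_inj; rewrite (gaussopE _ _ bG) (gaussopE _ _ bG).
have mE : measurable_fun [set: RR] (fun u : RR => (G (z + (u : R) *: x))%:E).
  by apply/measurable_EFinP; apply: measurable_bmeas_line; case: bG.
have E0 (u : R) : (0 <= (G (z + u *: x))%:E)%E by rewrite lee_fin.
rewrite -(ge0_integral_gaussN mE E0); apply: eq_integral => s _.
by rewrite scalerN scaleNr.
Qed.

(* One of [z + s x], [z - s x] lies below [z]. *)
Lemma gaussop_ge_half (x : V) (G : V -> R) z : bmeas G -> (forall z, 0 <= G z) ->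
  antitone G -> (forall k, 0 <= x k) -> 2^-1 * G z <= gaussop x G z.
Proof.
move=> bG G0 aG x0.
have i1 := gaussop_integrable z x bG.
have i2 := gaussop_integrable z (- x) bG.
suff : G z <= gaussop x G z + gaussop (- x) G z by rewrite gaussopN//; lra.
rewrite -{1}(gaussop_cst x (G z) z) /gaussop -RintegralD//.
apply: (le_Rintegral measurableT (gaussop_integrable z x (bmeas_cst (G z)))
  (integrableD measurableT i1 i2)) => s _.
have [s0|/ltW s0] := leP (s : R) 0.
  apply: (@le_trans _ _ (G (z + s *: x))); last by rewrite lerDl.
  by apply: aG => k; rewrite !ffunE gerDl scaleRE mulr_le0_ge0.
apply: (@le_trans _ _ (G (z + s *: - x))); last by rewrite lerDr.
by apply: aG => k; rewrite !ffunE gerDl scaleRE mulr_ge0_le0// oppr_le0.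
Qed.

Lemma gaussop_antitone (x : V) (G : V -> R) : bmeas G -> antitone G -> antitone (gaussop x G).
Proof.
move=> bG aG z z' zz'; apply: le_Rintegral => //; do ?exact: gaussop_integrable.
by move=> s _; apply: aG => k; rewrite !ffunE lerD2r.
Qed.

Lemma gaussops_antitone (xs : seq V) (G : V -> R) : bmeas G -> antitone G ->
  antitone (gaussops xs G).
Proof.
move=> bG aG; elim: xs => //= x xs IH; apply: gaussop_antitone => //.
exact: bmeas_gaussops.
Qed.

Lemma gaussops_ge0 (xs : seq V) (G : V -> R) :
  (forall z, 0 <= G z) -> forall z, 0 <= gaussops xs G z.
Proof. by move=> G0; elim: xs => //= x xs IH z; exact: gaussop_ge0. Qed.

(** Each discarded direction costs a factor 1/2; with one direction per block this is the origin of
    2^k. *)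
Lemma gaussops_ge_half (xs : seq V) (G : V -> R) z : bmeas G -> (forall z, 0 <= G z) ->
  antitone G -> (forall x, x \in xs -> forall k, 0 <= x k) ->
  2^-1 ^+ size xs * G z <= gaussops xs G z.
Proof.
move=> bG G0 aG; elim: xs z => [|x xs IH] z x0; first by rewrite /= expr0 mul1r.
rewrite exprS -mulrA /=.
apply: le_trans (gaussop_ge_half z (bmeas_gaussops xs bG) (gaussops_ge0 xs G0)
  (gaussops_antitone xs bG aG) _); last by apply: x0; rewrite inE eqxx.
by rewrite ler_wpM2l// IH// => y yx; apply: x0; rewrite inE yx orbT.
Qed.

End half.

(** * Gordon's inequality for finite families *)

Section finite_comparison.
Context {dT : measure_display} {T : measurableType dT} {R : realType}.
Variables (P : probability T R) (U : finType) (X : U -> T -> R).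
Hypothesis iidX : iid_std_normal P X.
Context {I J : finType}.
Local Notation V := {ffun I * J -> R}.

(** Within a row the Hessian of [testfun] has no definite sign, so covariances must agree there,
    variances included. Across rows it is nonpositive, so the larger covariance gives the smaller
    expectation. The directions [gs] are then discarded at the price of a factor 2 each. *)
Lemma integral_testfun_le (x y : U -> V) (gs : seq V) (m : V) :
  (forall g, g \in gs -> forall k, 0 <= g k) ->
  (forall k l : I * J, k.1 = l.1 ->
     cov (gs ++ [seq x u | u <- enum U]) k l = cov [seq y u | u <- enum U] k l) ->
  (forall k l : I * J,
     cov [seq y u | u <- enum U] k l <= cov (gs ++ [seq x u | u <- enum U]) k l) ->
  (\int[P]_t (testfun (m + \sum_u X u t *: x u))%:E <=
   (2 ^+ size gs)%:E * \int[P]_t (testfun (m + \sum_u X u t *: y u))%:E)%E.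
Proof.
move=> gs0 cov_eq cov_le.
have [p [q [s2 q0]]] := @testfun_smooth2 R I J.
have [[bK _ _] _] := s2.
have K0 z : 0 <= testfun z by case/andP: (testfun_itv z).
have uE : uniq (enum U) := enum_uniq U.
have intE (w : U -> V) : (\int[P]_t (testfun (m + \sum_u X u t *: w u))%:E =
    (gaussops [seq w u | u <- enum U] testfun m)%:E)%E.
  rewrite -(integral_lin_comb iidX w bK m uE).
  by apply: eq_integral => t _; rewrite big_enum.
rewrite !intE -EFinM lee_fin.
have := gaussops_le_of_cov m s2 (xs := gs ++ [seq x u | u <- enum U]) (ys := [seq y u | u <- enum U]).
move=> /(_ _)/le_trans H.
rewrite -ler_pdivrMl ?exprn_gt0// -exprVn.
apply: le_trans (H _ _ (lexx _)).
  rewrite gaussops_cat; apply: gaussops_ge_half => //.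
  - exact: bmeas_gaussops.
  - exact: gaussops_ge0.
  - by apply: gaussops_antitone => // z z' zz'; exact: testfun_antitone.
move=> z k l; have [kl|kl] := eqVneq k.1 l.1; first by rewrite cov_eq.
by rewrite ler_wnM2l// q0.
Qed.

End finite_comparison.

(** * The bilinear form and its decoupled surrogate *)

Section euclid.
Context {R : realType} {m : nat}.
Implicit Types x y : 'cV[R]_m.

Lemma dotvE x y : dotv x y = \sum_i x i 0 * y i 0.
Proof. by rewrite /dotv mxE; apply: eq_bigr => i _; rewrite mxE. Qed.

Lemma norm2_ge0 x : 0 <= norm2 x.
Proof. exact: sqrtr_ge0. Qed.

Lemma norm2_sqr x : norm2 x ^+ 2 = dotv x x.
Proof.
rewrite sqr_sqrtr; last by apply: sumr_ge0 => i _; exact: sqr_ge0.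
by rewrite dotvE; apply: eq_bigr => i _; rewrite expr2.
Qed.

(** The sum of the squares of x_i |y| - y_i |x| equals 2 |x| |y| (|x| |y| - <x, y>); zero norms are
    set apart in order to divide. *)
Lemma dotv_le_norm2 x y : dotv x y <= norm2 x * norm2 y.
Proof.
have eq0 (u v : 'cV[R]_m) : norm2 u = 0 -> dotv u v = 0.
  move=> u0; have : \sum_i u i 0 * u i 0 == 0 by rewrite -dotvE -norm2_sqr u0 expr0n.
  rewrite psumr_eq0 => [/allP u00|i _]; last by rewrite -expr2 sqr_ge0.
  rewrite dotvE big1// => i _; have := u00 i (mem_index_enum _).
  by rewrite /= mulf_eq0 orbb => /eqP ->; rewrite mul0r.
have dC (u v : 'cV[R]_m) : dotv u v = dotv v u.
  by rewrite !dotvE; apply: eq_bigr => i _; rewrite mulrC.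
have [x0|x0] := eqVneq (norm2 x) 0; first by rewrite eq0// x0 mul0r.
have [y0|y0] := eqVneq (norm2 y) 0; first by rewrite dC eq0// y0 mulr0.
have h : 0 <= \sum_i (x i 0 * norm2 y - y i 0 * norm2 x) ^+ 2.
  by apply: sumr_ge0 => i _; exact: sqr_ge0.
have e : \sum_i (x i 0 * norm2 y - y i 0 * norm2 x) ^+ 2 =
    2 * (norm2 x * norm2 y) * (norm2 x * norm2 y - dotv x y).
  transitivity (norm2 y ^+ 2 * dotv x x + norm2 x ^+ 2 * dotv y y
    - 2 * (norm2 x * norm2 y) * dotv x y).
    rewrite !dotvE !mulr_sumr -sumrN -!big_split/=; apply: eq_bigr => i _; ring.
  rewrite -!norm2_sqr; ring.
have n0 : 0 < 2 * (norm2 x * norm2 y).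
  by rewrite !mulr_gt0// lt_def ?x0 ?y0 norm2_ge0.
by rewrite e pmulr_rge0// subr_ge0 in h.
Qed.

End euclid.

Section concrete_comparison.
Context {dT : measure_display} {T : measurableType dT} {R : realType}.
Variable P : probability T R.
Variables (k d : nat) (n : 'I_k -> nat).
Variables (A : 'I_k -> 'M[R]_d) (a : 'I_k -> 'cV[R]_d)
  (B : forall l : 'I_k, 'M[R]_(n l)) (b : forall l : 'I_k, 'cV[R]_(n l))
  (G : forall l : 'I_k, T -> 'M[R]_(n l, d)) (g : 'I_k -> T -> 'cV[R]_d)
  (h : forall l : 'I_k, T -> 'cV[R]_(n l)) (psi : 'cV[R]_d -> vprod R n -> R).
Hypothesis iidX : iid_std_normal P (gentries G g h).

Let al l (w : 'cV[R]_d) := affine (A l) (a l) w.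
Let be l (v : vprod R n) : 'cV[R]_(n l) := affine (B l) (b l) (v l).

(** The objective as a linear form in all Gaussian entries. Zero coefficients on the entries of [g]
    and [h] place it on the same index set as [phi_coef]. *)
Definition Phi_coef (w : 'cV[R]_d) (v : vprod R n) (u : gidx d n) : R :=
  let: existT l e := u in
  match e with
  | inl (inl (i, j)) => be l v i 0 * al l w j 0
  | _ => 0
  end.

Definition phi_coef (w : 'cV[R]_d) (v : vprod R n) (u : gidx d n) : R :=
  let: existT l e := u in
  match e with
  | inl (inl _) => 0
  | inl (inr j) => norm2 (be l v) * al l w j 0
  | inr i => norm2 (al l w) * be l v i 0
  end.

Lemma sum_gidx (F : gidx d n -> R) :
  \sum_u F u = \sum_l (\sum_i \sum_j F (existT _ l (inl (inl (i, j))))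
    + \sum_j F (existT _ l (inl (inr j))) + \sum_i F (existT _ l (inr i))).
Proof.
transitivity (\sum_l \sum_(e : ('I_(n l) * 'I_d + 'I_d) + 'I_(n l)) F (existT _ l e)).
  rewrite (@sig_big_dep _ 0 +%R _
    (fun l => (('I_(n l) * 'I_d + 'I_d) + 'I_(n l))%type : finType)
    predT (fun=> predT) (fun l e => F (existT _ l e)))/=.
  by apply: eq_bigr => -[l e] _.
apply: eq_bigr => l _.
rewrite big_sumType/= big_sumType/=; congr (_ + _ + _).
by rewrite pair_big/=; apply: eq_bigr => -[i j] _.
Qed.

Lemma PhiObj_coef w v t : PhiObj A a B b psi (fun l => G l t) w v =
  \sum_u gentries G g h u t * Phi_coef w v u + psi w v.
Proof.
rewrite sum_gidx/=; congr (_ + _); apply: eq_bigr => l _.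
rewrite [X in _ + X + _]big1 ?addr0 => [|j _]; last by rewrite mulr0.
rewrite [X in _ + X]big1 ?addr0 => [|i _]; last by rewrite mulr0.
rewrite dotvE; apply: eq_bigr => i _; rewrite [(G l t *m _) i 0]mxE mulr_sumr; apply: eq_bigr => j _.
by rewrite mulrCA.
Qed.

Lemma phiObj_coef w v t : phiObj A a B b psi (fun l => g l t) (fun l => h l t) w v =
  \sum_u gentries G g h u t * phi_coef w v u + psi w v.
Proof.
rewrite sum_gidx/=; congr (_ + _); apply: eq_bigr => l _.
rewrite [X in X + _ + _]big1 ?add0r => [|i _]; last by rewrite big1// => j _; rewrite mulr0.
rewrite !dotvE !mulr_sumr; congr (_ + _); apply: eq_bigr => i _; by rewrite mulrCA.
Qed.

Lemma Phi_coef_cov w v w' v' : \sum_u Phi_coef w v u * Phi_coef w' v' u =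
  \sum_l dotv (al l w) (al l w') * dotv (be l v) (be l v').
Proof.
rewrite sum_gidx/=; apply: eq_bigr => l _.
rewrite [X in _ + X + _]big1 ?addr0 => [|j _]; last by rewrite mulr0.
rewrite [X in _ + X]big1 ?addr0 => [|i _]; last by rewrite mulr0.
rewrite !dotvE mulrC mulr_suml; apply: eq_bigr => i _.
by rewrite mulr_sumr; apply: eq_bigr => j _; ring.
Qed.

Lemma phi_coef_cov w v w' v' : \sum_u phi_coef w v u * phi_coef w' v' u =
  \sum_l (norm2 (be l v) * norm2 (be l v') * dotv (al l w) (al l w') +
          norm2 (al l w) * norm2 (al l w') * dotv (be l v) (be l v')).
Proof.
rewrite sum_gidx/=; apply: eq_bigr => l _.
rewrite [X in X + _ + _]big1 ?add0r => [|i _]; last by rewrite big1// => j _; rewrite mulr0.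
by rewrite !dotvE !mulr_sumr; congr (_ + _); apply: eq_bigr => i _; ring.
Qed.

Lemma cov_map_ffun {K : finType} {W : Type} (r : seq W) (F : W -> K -> R) (p q : K) :
  cov [seq [ffun c => F u c] | u <- r] p q = \sum_(u <- r) F u p * F u q.
Proof. by rewrite /cov big_map; apply: eq_bigr => u _; rewrite !ffunE. Qed.

(* [mu] will be plus or minus a large scaling factor; the minus sign, with rows
   indexed by [v], is used for the upper bound on Phi. *)
Lemma integral_testfun_Phi_le (I J : finType) (w : I * J -> 'cV[R]_d)
    (v : I * J -> vprod R n) (mu : R) (m : I * J -> R) :
  (forall c c' : I * J, c.1 = c'.1 -> w c = w c' \/ v c = v c') ->
  (\int[P]_t (testfun [ffun c => (mu * PhiObj A a B b psi (fun l => G l t) (w c) (v c) + m c)%R])%:E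
   <= (2 ^+ k)%:E * \int[P]_t (testfun
     [ffun c => (mu * phiObj A a B b psi (fun l => g l t) (fun l => h l t) (w c) (v c) + m c)%R])%:E)%E.
Proof.
move=> wv.
pose M : {ffun I * J -> R} := [ffun c => mu * psi (w c) (v c) + m c].
pose x u : {ffun I * J -> R} := [ffun c => mu * Phi_coef (w c) (v c) u].
pose y u : {ffun I * J -> R} := [ffun c => mu * phi_coef (w c) (v c) u].
(* The factor is the absolute value of [mu]: discarding these directions requires nonnegative
   entries, while covariances only see the square of [mu]. *)
pose gs : seq {ffun I * J -> R} :=
  [seq [ffun c => `|mu| * (norm2 (al l (w c)) * norm2 (be l (v c)))] | l <- enum 'I_k].
have covx c c' : cov (gs ++ [seq x u | u <- enum (gidx d n)]) c c' =
    mu ^+ 2 * \sum_l ((norm2 (al l (w c)) * norm2 (al l (w c'))) * (norm2 (be l (v c)) * norm2 (be l (v c')))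
      + dotv (al l (w c)) (al l (w c')) * dotv (be l (v c)) (be l (v c'))).
  rewrite /cov big_cat/= -!/(cov _ _ _) !cov_map_ffun !big_enum/= big_split/= mulrDr; congr (_ + _).
    rewrite mulr_sumr; apply: eq_bigr => l _.
    by rewrite -(real_normK (num_real mu)); ring.
  rewrite -Phi_coef_cov mulr_sumr; apply: eq_bigr => u _; ring.
have covy c c' : cov [seq y u | u <- enum (gidx d n)] c c' =
    mu ^+ 2 * \sum_l (norm2 (be l (v c)) * norm2 (be l (v c')) * dotv (al l (w c)) (al l (w c')) +
          norm2 (al l (w c)) * norm2 (al l (w c')) * dotv (be l (v c)) (be l (v c'))).
  by rewrite cov_map_ffun big_enum/= -phi_coef_cov mulr_sumr; apply: eq_bigr => u _; ring.
have sumE coef c t : (\sum_u gentries G g h u t *: ([ffun c => mu * coef (w c) (v c) u]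
    : {ffun I * J -> R})) c = mu * \sum_u gentries G g h u t * coef (w c) (v c) u.
  rewrite sum_ffunE mulr_sumr; apply: eq_bigr => u _.
  by rewrite !ffunE scaleRE mulrCA.
have := @integral_testfun_le _ _ _ P _ _ iidX I J x y gs M.
rewrite size_map size_enum_ord => H.
rewrite (_ : (fun t => (testfun _)%:E) = fun t => (testfun (M + \sum_u gentries G g h u t *: x u))%:E); last first.
  apply/funext => t; congr (testfun _)%:E; apply/ffunP => c.
  by rewrite [RHS]ffunE sumE !ffunE PhiObj_coef; ring.
rewrite [X in (_ * \int[P]_t X t)%E](_ : _ = fun t => (testfun (M + \sum_u gentries G g h u t *: y u))%:E); last first.
  apply/funext => t; congr (testfun _)%:E; apply/ffunP => c.
  by rewrite [RHS]ffunE sumE !ffunE phiObj_coef; ring.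
apply: H.
- move=> _ /mapP[l _ ->] c; rewrite ffunE !mulr_ge0//; exact: norm2_ge0.
- move=> c c' /wv cc'; rewrite covx covy; congr (_ * _); apply: eq_bigr => l _.
  by case: cc' => ->; rewrite -!expr2 norm2_sqr; ring.
- move=> c c'; rewrite covx covy ler_wpM2l ?sqr_ge0//; apply: ler_sum => l _.
  have h1 := dotv_le_norm2 (al l (w c)) (al l (w c')).
  have h2 := dotv_le_norm2 (be l (v c)) (be l (v c')).
  have : 0 <= (norm2 (al l (w c)) * norm2 (al l (w c')) - dotv (al l (w c)) (al l (w c')))
      * (norm2 (be l (v c)) * norm2 (be l (v c')) - dotv (be l (v c)) (be l (v c'))).
    by rewrite mulr_ge0// subr_ge0.
  by rewrite !mulrBl !mulrBr; lra.
Qed.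

End concrete_comparison.

(** * Minimax and compactness *)

Section minimax_theorem.
Context {R : realType}.

Section two_point.
Context {W : Type} (mix : R -> W -> W -> W).

Definition mix_closed (X : set W) :=
  forall t x y, 0 <= t <= 1 -> X x -> X y -> X (mix t x y).

Definition mix_convex (X : set W) (f : W -> R) := forall t x y, 0 <= t <= 1 ->
  X x -> X y -> f (mix t x y) <= t * f x + (1 - t) * f y.

(* The constraints on [l] are an upper bound for each [x] with [f x < 0] and a
   lower bound for each [x] with [g x < 0]; a conflicting pair would have a
   convex combination at which both [f] and [g] are negative. *)
Lemma two_point_minimax (X : set W) (f g : W -> R) : mix_closed X ->
  mix_convex X f -> mix_convex X g ->
  (forall x, X x -> 0 <= f x \/ 0 <= g x) ->
  exists2 l, 0 <= l <= 1 & forall x, X x -> 0 <= l * f x + (1 - l) * g x.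
Proof.
move=> cX cf cg fg.
have [[x1 [Xx1 gx1]]|noneg] := pselect (exists x, X x /\ g x < 0); last first.
  exists 0; first by rewrite lexx ler01.
  move=> x Xx; rewrite mul0r add0r subr0 mul1r leNgt; apply/negP => gx.
  by apply: noneg; exists x.
pose lo (x : W) := - g x / (f x - g x).
pose S : set R := [set lo x | x in [set x | X x /\ g x < 0]].
have f0 x : X x -> g x < 0 -> 0 <= f x by move=> Xx gx; case: (fg x Xx) => //; lra.
have lo1 x : X x -> g x < 0 -> 0 <= lo x <= 1.
  move=> Xx gx; have fx := f0 x Xx gx; apply/andP; split.
    by apply: divr_ge0; lra.
  by rewrite ler_pdivrMr; lra.
have supS : has_sup S.
  by split; [exists (lo x1); exists x1|exists 1 => _ [x [Xx gx] <-]; case/andP: (lo1 x Xx gx)].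
have l_ge x : X x -> g x < 0 -> lo x <= sup S.
  by move=> Xx gx; apply: ub_le_sup; [case: supS|exists x].
have l0 : 0 <= sup S by apply: le_trans (l_ge x1 Xx1 gx1); case/andP: (lo1 x1 Xx1 gx1).
have l1 : sup S <= 1.
  by apply: ge_sup; [case: supS|move=> _ [x [Xx gx] <-]; case/andP: (lo1 x Xx gx)].
exists (sup S); first by rewrite l0.
move=> x Xx; have [gx|gx] := ltP (g x) 0.
  have := l_ge x Xx gx; have fx := f0 x Xx gx.
  rewrite /lo ler_pdivrMr; last lra.
  by lra.
have [fx|fx] := ltP (f x) 0; last by rewrite addr_ge0// mulr_ge0// subr_ge0.
suff : sup S <= g x / (g x - f x) by rewrite ler_pdivlMr; lra.
apply: ge_sup; first by case: supS.
move=> _ [y [Xy gy] <-]; have fy := f0 y Xy gy.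
rewrite /lo ler_pdivrMr; last lra.
rewrite mulrAC ler_pdivlMr; last lra.
rewrite leNgt; apply/negP => bad.
have bad' : g x * f y < f x * g y by lra.
(* With weight t, the segment between (f x, g x) and (f y, g y) meets the diagonal; the common value
   there is (g x f y - f x g y)/D, negative by [bad']. *)
pose D := - f x + g x + f y - g y.
have D0 : 0 < D by rewrite /D; lra.
pose t := (f y - g y) / D.
have t01 : 0 <= t <= 1.
  rewrite /t divr_ge0//=; [|lra|exact: ltW].
  by rewrite ler_pdivrMr// mul1r /D; lra.
have t1 : 1 - t = (g x - f x) / D by rewrite /t /D; field; apply/eqP => e; move: D0; rewrite /D; lra.
have fm : f (mix t x y) < 0.
  apply: (le_lt_trans (cf _ _ _ t01 Xx Xy)).
  rewrite t1 /t mulrAC [_ / D * f y]mulrAC -mulrDl pmulr_llt0 ?invr_gt0//; lra.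
have gm : g (mix t x y) < 0.
  apply: (le_lt_trans (cg _ _ _ t01 Xx Xy)).
  rewrite t1 /t mulrAC [_ / D * g y]mulrAC -mulrDl pmulr_llt0 ?invr_gt0//; lra.
by case: (fg _ (cX _ _ _ t01 Xx Xy)); lra.
Qed.

End two_point.

Context {W V : Type} (mixW : R -> W -> W -> W) (mixV : R -> V -> V -> V).

(** Induction on the number of functions: where the first one falls below [al], a convex set, the
    others suffice and yield one point y'. The two-point lemma then merges y and y' into a single
    point of [Y]. *)
Lemma finite_minimax (Y : set V) (f : W -> V -> R) (al : R) (v0 : V) (X0 : set W) :
  mix_closed mixV Y -> Y v0 ->
  (forall y, Y y -> mix_convex mixW X0 (f ^~ y)) ->
  (forall x, X0 x -> forall t y y', 0 <= t <= 1 -> Y y -> Y y' ->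
     t * f x y + (1 - t) * f x y' <= f x (mixV t y y')) ->
  forall (ys : seq V) (X : set W), X `<=` X0 -> mix_closed mixW X ->
  (forall y, List.In y ys -> Y y) ->
  (forall x, X x -> exists2 y, List.In y ys & al <= f x y) ->
  exists2 y0, Y y0 & forall x, X x -> al <= f x y0.
Proof.
move=> cY Yv0 cf cc; elim => [|y ys IH] X XX0 cX ysY Xys.
  (* With no function left the set [X] is empty, and [v0] is a mere default. *)
  by exists v0 => // x /Xys[].
have Yy : Y y by apply: ysY; left.
pose X' := [set x | X x /\ f x y < al].
have [||||y' Yy' Hy'] := IH X'.
- by move=> x [/XX0].
- move=> t x x' t01 [Xx fx] [Xx' fx']; split; first exact: cX.
  apply: (le_lt_trans (cf y Yy t x x' t01 (XX0 _ Xx) (XX0 _ Xx'))).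
  have [->|t0] := eqVneq t 0; first by rewrite mul0r subr0 mul1r add0r.
  case/andP: t01 => t0' t1.
  have : 0 < t by rewrite lt_def t0.
  by nra.
- by move=> z zys; apply: ysY; right.
- move=> x [Xx fx]; have [z [<-|zys] fz] := Xys x Xx; last by exists z.
  by move: fz; rewrite leNgt fx.
have cvx z : Y z -> mix_convex mixW X (fun x => f x z - al).
  move=> Yz t x x' t01 Xx Xx'; have := cf z Yz t x x' t01 (XX0 _ Xx) (XX0 _ Xx').
  by lra.
have [|l l01 Hl] := two_point_minimax cX (cvx y Yy) (cvx y' Yy').
  move=> x Xx; have [fx|fx] := leP al (f x y); first by left; lra.
  by right; have := Hy' x (conj Xx fx); lra.
exists (mixV l y y'); first exact: cY.
move=> x Xx; apply: le_trans (cc x (XX0 _ Xx) l y y' l01 Yy Yy').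
by have := Hl x Xx; lra.
Qed.

End minimax_theorem.

(** * Compactness arguments *)

Section compactness.

(** A finite subcover, extracted by applying the covering form of compactness to the filter of
    finite sequences ordered by inclusion. *)
Lemma compact_finite_choice {W : topologicalType} {I : Type} (X : set W)
    (Q : W -> I -> Prop) (c : W -> I) :
  compact X -> (forall x, X x -> \forall x' \near x, X x' -> Q x' (c x)) ->
  exists2 s : seq W, (forall x, x \in s -> X x) &
    forall x, X x -> exists2 y, y \in s & Q x (c y).
Proof.
move=> cX HX.
pose D := [set s : seq W | forall x, x \in s -> X x].
pose F := filter_from D (fun s => [set s' : seq W | {subset s <= s'}]).
have FF : Filter F.
  apply: filter_from_filter; first by exists [::].
  move=> s s' Ds Ds'; exists (s ++ s').
    by move=> x; rewrite mem_cat => /orP[/Ds|/Ds'].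
  by move=> t st; split => x xs; apply: st; rewrite mem_cat xs ?orbT.
have [s Ds Hs] : \forall s \near F, X `<=` (fun x => X x -> exists2 y, y \in s & Q x (c y)).
  apply: (proj1 (compact_near_coveringP X) cX (seq W) F
    (fun s x => X x -> exists2 y, y \in s & Q x (c y))) => x Xx.
  exists ([set x' | X x' -> Q x' (c x)], [set s : seq W | x \in s]).
    split => /=; first exact: HX.
    exists [:: x]; first by move=> y; rewrite inE => /eqP ->.
    by move=> s; apply; rewrite inE.
  by move=> [x' s] [/= Qx' xs] Xx'; exists x => //; exact: Qx'.
by exists s => // x Xx; exact: (Hs s (fun _ h => h) x Xx).
Qed.

(** If every x had some y with f x y > [al], semicontinuity and compactness would leave finitely
    many such y, and the finite case would give one y0 with f >= [al] on all of [X]. The strict gap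
    between [be] and [al] then yields the contradiction. *)
Lemma compact_minimax {R : realType} {W : topologicalType} {V : Type}
    (mixW : R -> W -> W -> W) (mixV : R -> V -> V -> V)
    (X : set W) (Y : set V) (f : W -> V -> R) (al be : R) :
  compact X -> mix_closed mixW X -> mix_closed mixV Y ->
  (forall y, Y y -> mix_convex mixW X (f ^~ y)) ->
  (forall x, X x -> forall t y y', 0 <= t <= 1 -> Y y -> Y y' ->
     t * f x y + (1 - t) * f x y' <= f x (mixV t y y')) ->
  (forall x y, X x -> Y y -> al < f x y -> \forall x' \near x, X x' -> al < f x' y) ->
  be < al ->
  (exists y, Y y) ->
  (forall y, Y y -> exists2 x, X x & f x y <= be) ->
  exists2 x, X x & forall y, Y y -> f x y <= al.
Proof.
move=> cpX cX cY cf cc usc ba [v0 Yv0] HY.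
apply: contrapT => noX.
have Hx x : exists y, X x -> Y y /\ al < f x y.
  have [Xx|nXx] := pselect (X x); last by exists v0.
  apply: contrapT => noy; apply: noX; exists x => // y Yy.
  by rewrite leNgt; apply/negP => fa; apply: noy; exists y.
have [c Hc] := choice Hx.
have [|s sX Hs] := @compact_finite_choice W V X (fun x y => al < f x y) c cpX.
  by move=> x Xx; apply: usc => //; case: (Hc x Xx).
have [||y0 Yy0 fy0] := finite_minimax cY Yv0 cf cc (ys := [seq c x | x <- s]) (X := X) (al := al) (fun x Xx => Xx) cX.
- elim: s sX {Hs} => //= x s IH sX y [<-|ys].
    by case: (Hc x) => //; apply: sX; rewrite inE eqxx.
  by apply: IH => // z zs; apply: sX; rewrite inE zs orbT.
- move=> x Xx; have [y ys fxy] := Hs x Xx; exists (c y); last exact: ltW.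
  elim: s ys {sX Hs} => //= z s IH; rewrite inE => /orP[/eqP ->|ys]; first by left.
  by right; exact: IH.
have [x Xx fb] := HY y0 Yy0.
by have := fy0 x Xx; lra.
Qed.

Lemma near_lt_within {R : realType} {W V : topologicalType} (X : set W) (Y : set V)
    (f : W -> V -> R) (al : R) :
  {within X `*` Y, continuous (fun p : W * V => f p.1 p.2)} ->
  forall x y, X x -> Y y -> al < f x y ->
  \forall x' \near x & y' \near y, X x' -> Y y' -> al < f x' y'.
Proof.
move=> /subspace_continuousP cf x y Xx Yy fa.
have /(_ [set r | al < r]) := cf (x, y) (conj Xx Yy).
have nb : nbhs (f x y) [set r | al < r] by apply: open_nbhs_nbhs; split => //; exact: open_gt.
move=> /(_ nb); rewrite /= /within/= => H.
have [[U U'] [/= nU nU'] UU] := H.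
exists (U, U') => //= -[x' y'] [/= Ux' Uy'] Xx' Yy'.
exact: (UU (x', y')).
Qed.

Lemma near_lt_within_fst {R : realType} {W V : topologicalType} (X : set W) (Y : set V)
    (f : W -> V -> R) (al : R) :
  {within X `*` Y, continuous (fun p : W * V => f p.1 p.2)} ->
  forall x y, X x -> Y y -> al < f x y -> \forall x' \near x, X x' -> al < f x' y.
Proof.
move=> cf x y Xx Yy fxy.
have [[U U'] [/= nU nU'] UU] := near_lt_within cf Xx Yy fxy.
apply: filterS nU => x' Ux' Xx'; apply: (UU (x', y)) => //=; split => //.
exact: nbhs_singleton.
Qed.

(** The tube lemma, with compactness of [Y] making the neighbourhood of x independent of y. *)
Lemma near_row_lt {R : realType} {W V : topologicalType} (X : set W) (Y : set V)
    (f : W -> V -> R) (al : R) :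
  {within X `*` Y, continuous (fun p : W * V => f p.1 p.2)} -> compact Y ->
  forall x, X x -> (forall y, Y y -> f x y < al) ->
  \forall x' \near x, X x' -> forall y, Y y -> f x' y < al.
Proof.
move=> cf cY x Xx fa.
have cf' : {within X `*` Y, continuous (fun p : W * V => - f p.1 p.2)}.
  by move=> p; apply: continuousN; exact: cf.
have H : \forall x' \near x, Y `<=` (fun y => X x' -> Y y -> f x' y < al).
  apply: (proj1 (compact_near_coveringP Y) cY W (nbhs x)
    (fun x' y => X x' -> Y y -> f x' y < al)).
  move=> y Yy.
  have := @near_lt_within R W V X Y (fun x y => - f x y) (- al) cf' x y Xx Yy.
  rewrite ltrN2 => /(_ (fa y Yy)) [[U U'] [/= nU nU'] UU].
  exists (U', U) => //= -[y' x'] [/= Uy' Ux'] Xx' Yy'.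
  by have := UU (x', y') (conj Ux' Uy') Xx' Yy'; rewrite ltrN2.
by apply: filterS H => x' H Xx' y Yy; exact: H.
Qed.

Definition evt_dense {W : topologicalType} (X : set W) (I : nat -> finType)
  (s : forall n, I n -> W) : Prop :=
  (forall n i, X (s n i)) /\
  forall x U, X x -> nbhs x U -> \forall n \near \oo, exists i, U (s n i).

(** Compactness makes the threshold for n uniform in x, so the conclusion applies to whichever rows
    are selected at stage n. *)
Lemma evt_dense_col_lt {R : realType} {W V : topologicalType} (X : set W) (Y : set V)
    (f : W -> V -> R) (al : R) (J : nat -> finType) (s : forall n, J n -> V) :
  {within X `*` Y, continuous (fun p : W * V => f p.1 p.2)} -> compact X ->
  evt_dense Y s ->
  (forall x, X x -> exists2 y, Y y & al < f x y) ->
  \forall n \near \oo, forall x, X x -> exists j, al < f x (s n j).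
Proof.
move=> cf cX [sY ds] fa.
have H : \forall n \near \oo, X `<=` (fun x => X x -> exists j, al < f x (s n j)).
  apply: (proj1 (compact_near_coveringP X) cX nat \oo
    (fun n x => X x -> exists j, al < f x (s n j))).
  move=> x Xx; have [y Yy fxy] := fa x Xx.
  have [[U U'] [/= nU nU'] UU] := near_lt_within cf Xx Yy fxy.
  exists (U, [set n | exists j, U' (s n j)]); first by split => //=; exact: ds Yy nU'.
  move=> [x' n] [/= Ux' [j Uj]] Xx'; exists j.
  by have := UU (x', s n j) (conj Ux' Uj) Xx' (sY n j).
by apply: filterS H => n H x Xx; exact: H.
Qed.

Lemma evt_dense_row_lt {R : realType} {W V : topologicalType} (X : set W) (Y : set V)
    (f : W -> V -> R) (al : R) (I : nat -> finType) (s : forall n, I n -> W) :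
  {within X `*` Y, continuous (fun p : W * V => f p.1 p.2)} -> compact Y ->
  evt_dense X s ->
  (exists2 x, X x & forall y, Y y -> f x y < al) ->
  \forall n \near \oo, exists i, forall y, Y y -> f (s n i) y < al.
Proof.
move=> cf cY [sX ds] [x Xx fx].
have := ds x _ Xx (near_row_lt cf cY Xx fx).
by apply: filterS => n [i Hi]; exists i => y Yy; exact: Hi.
Qed.

(** An enumeration of the union of finite nets of mesh 1/(m+1). *)
Lemma compact_dense_seq {R : realType} {W : pseudoMetricType R} (X : set W) :
  compact X -> (exists x, X x) ->
  exists u : nat -> W, (forall i, X (u i)) /\
    forall x U, X x -> nbhs x U -> exists i, U (u i).
Proof.
move=> cX [x0 Xx0].
have H (m : nat) : exists s : seq W, (forall x, x \in s -> X x) /\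
    forall x, X x -> exists2 y, y \in s & ball x (m.+1%:R^-1) y.
  have [|s sX Hs] := @compact_finite_choice W W X (fun x y => ball x (m.+1%:R^-1) y) id cX.
    move=> x Xx; near=> x' => _; apply: ball_sym; near: x'.
    by apply: nbhsx_ballx; rewrite invr_gt0.
  by exists s.
have [s Hs] := choice H.
(* A code of (m, j) stands for the j-th point of the m-th net; [x0] fills invalid codes and
   positions beyond the end. *)
pose u i := if @unpickle (nat * nat)%type i is Some (m, j) then nth x0 (s m) j else x0.
exists u; split.
  move=> i; rewrite /u; case: unpickle => [[m j]|//].
  have [jm|jm] := ltnP j (size (s m)); last by rewrite nth_default.
  by apply: (Hs m).1; exact: mem_nth.
move=> x U Xx /nbhs_ballP[e /= e0 eU].
pose m := Num.truncn e^-1.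
have [y ys xy] := (Hs m).2 x Xx.
exists (pickle (m, index y (s m))); rewrite /u pickleK nth_index//.
apply: eU; apply: le_ball xy.
rewrite invf_ple ?posrE//.
by rewrite ltW// truncnS_gt.
Unshelve. all: by end_near. Qed.

End compactness.

(** * Limits of probabilities along the families *)

(** * From finite families to compact sets *)

Section transfer.
Context {dT : measure_display} {T : measurableType dT} {R : realType}.
Variable P : probability T R.

Lemma measurable_le_cst (F : T -> R) (c : R) : measurable_fun setT F ->
  measurable [set t | F t <= c].
Proof.
move=> mF; have := mF measurableT _ (measurable_itv `]-oo, c]).
rewrite setTI (_ : _ @^-1` _ = [set t | F t <= c])//.
Qed.

Lemma measurable_evt_le (F : nat -> T -> R) (c : nat -> R) :
  (forall n, measurable_fun setT (F n)) ->
  forall m, measurable [set t | forall n, (m <= n)%N -> F n t <= c n].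
Proof.
move=> mF m.
rewrite (_ : [set t | _] = \bigcap_(n in [set n | (m <= n)%N]) [set t | F n t <= c n]).
  by apply: bigcap_measurableType => n _; exact: measurable_le_cst.
by apply/seteqP; split => t /= H n; exact: H.
Qed.

(** Continuity from below: the events on which the inequality holds from m on increase to [E]. *)
Lemma evt_le_cvg (F : nat -> T -> R) (c : nat -> R) (E : set T) :
  measurable E -> (forall n, measurable_fun setT (F n)) ->
  (forall t, E t -> \forall n \near \oo, F n t <= c n) ->
  forall e, 0 < e -> \forall m \near \oo,
   fine (P E) - e <= fine (P [set t | E t /\ forall n, (m <= n)%N -> F n t <= c n]).
Proof.
move=> mE mF EF e e0.
pose B m := [set t | E t /\ forall n, (m <= n)%N -> F n t <= c n].
have BE m : B m = E `&` [set t | forall n, (m <= n)%N -> F n t <= c n] by [].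
have mB m : measurable (B m) by rewrite BE; apply: measurableI => //; exact: measurable_evt_le.
have Bu : \bigcup_m B m = E.
  apply/seteqP; split => [t [m _ []//]|t Et].
  by have [m _ Hm] := EF t Et; exists m => //; split => // n /Hm.
have ndB : nondecreasing_seq B.
  by move=> i j ij; apply/subsetPset => t [Et Ht]; split => // n jn; apply: Ht; exact: leq_trans jn.
have cv : P \o B @ \oo --> P E.
  rewrite -[X in P X]Bu; apply: nondecreasing_cvg_mu => //.
  by rewrite Bu.
have PfE : P E = (fine (P E))%:E by rewrite fineK// fin_num_measure.
rewrite PfE in cv; have /fine_cvgP[_ /cvgrPdist_le /(_ e e0)] := cv.
by apply: filterS => m /=; rewrite ler_norml => /andP[_]; rewrite /comp -/(B m); lra.
Qed.

(** In the limit, [F n] dominates the indicator of the failure of [Q] and [H n] is at most the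
    indicator of the complement of [E]. As [Q] may fail to be measurable, the event produced is the
    complement of [B'], the measurable set on which [F n] is eventually close to 1. *)
Lemma fatou_transfer (F H : nat -> T -> R) (C eps : R) (E : set T) (Q : T -> Prop) :
  0 <= C ->
  (forall n, measurable_fun setT (F n)) -> (forall n, measurable_fun setT (H n)) ->
  (forall n t, 0 <= F n t <= 1) -> (forall n t, 0 <= H n t <= 1) ->
  (forall n, \int[P]_t (F n t)%:E <= C%:E * \int[P]_t (H n t)%:E)%E ->
  measurable E -> ((1 - eps)%:E <= P E)%E ->
  (forall t, E t -> \forall n \near \oo, H n t <= n.+1%:R^-1) ->
  (forall t, ~ Q t -> \forall n \near \oo, 1 - n.+1%:R^-1 <= F n t) ->
  wp_atleast P (1 - C * eps) Q.
Proof.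
move=> C0 mF mH F01 H01 FH mE PE HE FQ.
have Pfin (Y : set T) : measurable Y -> P Y = (fine (P Y))%:E.
  by move=> mY; rewrite fineK// fin_num_measure.
have P01 (Y : set T) : measurable Y -> 0 <= fine (P Y) <= 1.
  move=> mY; rewrite fine_ge0//= -lee_fin -Pfin//; exact: probability_le1.
have iF n : P.-integrable setT (EFin \o F n).
  apply: (@bounded_integrable _ _ _ P (F n) 1) => // t.
  by case/andP: (F01 n t) => h0 h1; rewrite ger0_norm.
have iH n : P.-integrable setT (EFin \o H n).
  apply: (@bounded_integrable _ _ _ P (H n) 1) => // t.
  by case/andP: (H01 n t) => h0 h1; rewrite ger0_norm.
have fE (f : T -> R) : P.-integrable setT (EFin \o f) ->
    (\int[P]_t (f t)%:E = (\int[P]_t f t)%:E)%E.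
  by move=> i; rewrite /Rintegral fineK//; exact: integrable_fin_num i.
have iI (Y : set T) : measurable Y -> P.-integrable setT (EFin \o (\1_Y : T -> R)).
  move=> mY; apply: (@bounded_integrable _ _ _ P _ 1).
    exact: measurable_indic.
  by move=> t; rewrite indicE; case: (_ \in _); rewrite ?normr1 ?normr0.
have IE (Y : set T) : measurable Y -> \int[P]_t (\1_Y t) = fine (P Y).
  by move=> mY; rewrite /Rintegral integral_indic// setIT.
pose B m := [set t | forall n, (m <= n)%N -> - F n t <= n.+1%:R^-1 - 1].
have mNF n : measurable_fun setT (fun t => - F n t) by exact: measurableT_comp.
have mB m : measurable (B m) by exact: (measurable_evt_le (fun n => n.+1%:R^-1 - 1) mNF).
pose B' := \bigcup_m B m.
have mB' : measurable B' by exact: bigcup_measurable.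
have eps1 : 1 - eps <= fine (P E) by rewrite -lee_fin -Pfin.
have PB' : fine (P B') <= C * eps.
  apply/ler_addgt0Pr => e e0.
  (* The losses: one e' for passing to [B''], one for the factor 1 - r, and 2 e' in the integral of
     [H n], multiplied by C. The 3 leaves room. *)
  pose e' := e / (3 + 2 * C).
  have c0 : 0 < 3 + 2 * C by lra.
  have e'0 : 0 < e' by exact: divr_gt0.
  have h1 := evt_le_cvg mE mH HE e'0.
  have B'F t : B' t -> \forall n \near \oo, - F n t <= n.+1%:R^-1 - 1.
    by move=> [m _ Bm]; exists m.
  have h2 := evt_le_cvg mB' mNF B'F e'0.
  have h3 : \forall n \near \oo, n.+1%:R^-1 <= e' :> R.
    have /cvgrPdist_le/(_ _ e'0) := @cvg_harmonic R.
    by apply: filterS => n /=; rewrite sub0r normrN ger0_norm.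
  have [n _ /(_ n (leqnn n)) [{}h1 [{}h2 {}h3]]] := filterI h1 (filterI h2 h3).
  pose E' := [set t | E t /\ forall j, (n <= j)%N -> H j t <= j.+1%:R^-1].
  pose B'' := [set t | B' t /\ forall j, (n <= j)%N -> - F j t <= j.+1%:R^-1 - 1].
  have mE' : measurable E' by apply: measurableI => //; exact: measurable_evt_le.
  have mB'' : measurable B'' by apply: measurableI => //; exact: (measurable_evt_le (fun n => n.+1%:R^-1 - 1) mNF).
  pose r : R := n.+1%:R^-1.
  have r0 : 0 <= r by rewrite invr_ge0.
  have r1 : r <= 1 by rewrite invf_le1// ler1n.
  have lowF : (1 - r) * fine (P B'') <= \int[P]_t F n t.
    rewrite -IE// -RintegralZl//; last exact: iI.
    apply: le_Rintegral => //; first exact: (integrableZl measurableT (1 - r) (iI _ mB'')).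
    move=> t _; rewrite indicE; case: (boolP (t \in B'')) => [|_].
      by rewrite inE => -[_ /(_ n (leqnn n))]; rewrite mulr1 -/r; lra.
    by rewrite mulr0; case/andP: (F01 n t).
  have mCE' := measurableC mE'.
  have highH : \int[P]_t H n t <= r + fine (P (~` E')).
    have -> : r + fine (P (~` E')) = \int[P]_t (r + \1_(~` E') t).
      rewrite RintegralD//; [|exact: finite_measure_integrable_cst|exact: iI].
      rewrite IE// Rintegral_cst//; congr (_ + _); rewrite -[LHS]mulr1.
      by congr (_ * _); exact: (esym (congr1 fine (@probability_setT _ _ _ P))).
    apply: le_Rintegral => //.
      exact: (integrableD measurableT (finite_measure_integrable_cst P r measurableT) (iI _ mCE')).
    move=> t _; rewrite indicE; case: (boolP (t \in ~` E')) => [_|].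
      by case/andP: (H01 n t) => _ /le_trans; apply; rewrite lerDr.
    by rewrite notin_setE/= => /contrapT -[_ /(_ n (leqnn n))]; rewrite addr0.
  have PCE' : fine (P (~` E')) = 1 - fine (P E').
    by rewrite probability_setC// (Pfin E')// -EFinB.
  have FHr : \int[P]_t F n t <= C * \int[P]_t H n t.
    by have := FH n; rewrite !fE// -EFinM lee_fin.
  have /andP[b0 b1] := P01 B'' mB''.
  rewrite -/r in h3; rewrite -/E' in h1; rewrite -/B'' in h2.
  have {}highH : C * \int[P]_t H n t <= C * (2 * e' + eps).
    by rewrite ler_wpM2l//; lra.
  have rb : r * fine (P B'') <= e' by apply: le_trans h3; rewrite ler_piMr.
  have ee : e = (3 + 2 * C) * e' by rewrite /e' mulrC divfK// gt_eqF.
  by rewrite ee; lra.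
exists (~` B'); split; first exact: measurableC.
split; last first.
  move=> t /= At; apply: contrapT => /FQ [m _ Ft]; apply: At; exists m => // n mn.
  by rewrite lerNl opprB; exact: Ft n mn.
rewrite probability_setC// (Pfin B')// -EFinB lee_fin; lra.
Qed.

End transfer.

(** * The one-sided comparison on compact sets *)

Section half_cgmt.
Context {dT : measure_display} {T : measurableType dT} {R : realType}.
Variable P : probability T R.

Lemma measurable_testfun (I J : finType) (z : T -> {ffun I * J -> R}) :
  (forall c, measurable_fun setT (fun t => z t c)) ->
  measurable_fun setT (fun t => testfun (z t)).
Proof.
move=> mz; have [p [q [[[[mK _] _ _] _] _]]] := @testfun_smooth2 R I J.
exact: (mK _ T z mz).
Qed.

(** At stage n the test function is taken at scale [L n], centred at c. The margin rho on either
    side lets compactness pass from the sets to the finite families. *)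
Lemma minmax_transfer {W V : topologicalType} (X : set W) (Y : set V)
    (Phi phi : T -> W -> V -> R) (I J : nat -> finType)
    (wn : forall n, I n -> W) (vn : forall n, J n -> V) (C c rho eps : R) :
  compact X -> compact Y -> evt_dense X wn -> evt_dense Y vn ->
  (forall t, {within X `*` Y, continuous (fun p : W * V => Phi t p.1 p.2)}) ->
  (forall t, {within X `*` Y, continuous (fun p : W * V => phi t p.1 p.2)}) ->
  (forall w v, measurable_fun setT (fun t => Phi t w v)) ->
  (forall w v, measurable_fun setT (fun t => phi t w v)) ->
  0 <= C -> 0 < rho ->
  (forall n (mu : R) (m : I n * J n -> R),
    (\int[P]_t (testfun [ffun e => (mu * Phi t (wn n e.1) (vn n e.2) + m e)%R])%:E <=
     C%:E * \int[P]_t (testfun [ffun e => (mu * phi t (wn n e.1) (vn n e.2) + m e)%R])%:E)%E) ->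
  wp_atleast P (1 - eps) (fun t => forall w, X w -> exists2 v, Y v & c + rho < phi t w v) ->
  wp_atleast P (1 - C * eps) (fun t => forall w, X w -> exists2 v, Y v & c - rho <= Phi t w v).
Proof.
move=> cX cY dX dY cPhi cphi mPhi mphi C0 rho0 comp [E [mE [PE HE]]].
(* The scale [L n] solves exp(- L n rho) = 1 / D n, which beats both cardinalities and leaves a
   factor 1/(n+1). *)
pose D n : R := (#|I n| + #|J n| + 1)%:R * n.+1%:R.
have D0 n : 0 < D n by rewrite mulr_gt0// addn1 ltr0n.
pose L n := ln (D n) / rho.
have D1 n : 1 <= D n.
  by rewrite /D -natrM ler1n muln_gt0 addn1.
have L0 n : 0 <= L n by rewrite divr_ge0 ?ln_ge0// ltW.
have eL n : expR (- (L n * rho)) = (D n)^-1.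
  by rewrite /L divfK ?gt_eqF// expRN lnK ?posrE.
have card_le (N n : nat) : (N <= #|I n| + #|J n| + 1)%N -> N%:R * expR (- (L n * rho)) <= n.+1%:R^-1.
  move=> Nn; rewrite eL /D invfM mulrA ler_piMl ?invr_ge0// ler_pdivrMr ?ltr0n ?addn1// mul1r.
  by rewrite ler_nat -addn1.
pose z (f : T -> W -> V -> R) n t : {ffun I n * J n -> R} :=
  [ffun e => L n * f t (wn n e.1) (vn n e.2) + - (L n * c)].
have mz f n : (forall w v, measurable_fun setT (fun t => f t w v)) ->
    measurable_fun setT (fun t => testfun (z f n t)).
  move=> mf; apply: measurable_testfun => e.
  under eq_fun do rewrite ffunE.
  by apply: measurable_funD => //; exact: measurable_funM.
apply: (@fatou_transfer _ _ _ P (fun n t => testfun (z Phi n t)) (fun n t => testfun (z phi n t)) C eps E) => //.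
- by move=> n; exact: mz.
- by move=> n; exact: mz.
- by move=> n t; exact: testfun_itv.
- by move=> n t; exact: testfun_itv.
- by move=> n; exact: comp.
- move=> t Et; have := evt_dense_col_lt (cphi t) cX dY (HE t Et).
  apply: filterS => n Hn.
  apply: le_trans (card_le #|I n| n _); last by rewrite -addnA leq_addr.
  apply: testfun_le => i; have [j cj] := Hn (wn n i) (dX.1 n i).
  by exists j; rewrite ffunE/= -mulrBr ler_wpM2l//; lra.
- move=> t nQ.
  have [w Xw Hw] : exists2 w, X w & forall v, Y v -> Phi t w v < c - rho.
    apply: contrapT => now; apply: nQ => w Xw; apply: contrapT => nov; apply: now.
    exists w => // v Yv; rewrite ltNge; apply/negP => h; apply: nov; by exists v.
  have := evt_dense_row_lt (cPhi t) cY dX (ex_intro2 _ _ w Xw Hw).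
  apply: filterS => n [i Hi].
  apply: (@le_trans _ _ (1 - #|J n|%:R * expR (- (L n * rho)))).
    by rewrite lerD2l lerN2 card_le// addnAC leq_addl.
  apply: testfun_ge; exists i => j; rewrite ffunE/= -mulrBr -mulrN ler_wpM2l//.
  by have := Hi _ (dY.1 n j); lra.
Qed.

End half_cgmt.

(** * Finite families in the product of the blocks *)

Section dense.
Context {R : realType}.

Lemma evt_dense_seq {W : topologicalType} (X : set W) (u : nat -> W) :
  (forall i, X (u i)) -> (forall x U, X x -> nbhs x U -> exists i, U (u i)) ->
  evt_dense X (fun n (i : 'I_n) => u i).
Proof.
move=> uX du; split=> [n i|x U Xx nU]; first exact: uX.
have [i Ui] := du x U Xx nU; exists i.+1 => // n /= i_n.
by exists (Ordinal i_n).
Qed.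

(** The filter generated by boxes converges to v for each coordinate topology, hence for their
    supremum, which is the product topology. *)
Lemma nbhs_vprod (k : nat) (n : 'I_k -> nat) (v : vprod R n) (U : set (vprod R n)) :
  nbhs v U -> exists2 N : forall l, set 'cV[R]_(n l),
    (forall l, nbhs (v l) (N l)) & forall v' : vprod R n, (forall l, N l (v' l)) -> U v'.
Proof.
move=> nU.
pose D := [set N : forall l, set 'cV[R]_(n l) | forall l, nbhs (v l) (N l)].
pose box (N : forall l, set 'cV[R]_(n l)) : set (vprod R n) := [set v' | forall l, N l (v' l)].
have FF : Filter (filter_from D box).
  apply: filter_from_filter; first by exists (fun=> setT) => l; exact: filterT.
  move=> N M DN DM; exists (fun l => N l `&` M l); first by move=> l; exact: filterI.
  by move=> v' H; split => l; case: (H l).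
have : filter_from D box --> v.
  apply/cvg_sup => l A [C [[Z oZ <-] /= Zv] sCA].
  (* [Z] lives in block [l]: it is transported along an equality of indices where there is one, and
     the other blocks are unconstrained. *)
  exists (fun l' => if l' =P l is ReflectT e then
     eq_rect_r (fun l' => set 'cV[R]_(n l')) Z e else setT).
    move=> l' /=; case: eqP => [e|_]; last exact: filterT.
    by subst l'; rewrite /eq_rect_r /=; exact: open_nbhs_nbhs.
  move=> v' /(_ l) /=; case: eqP => // e.
  by rewrite (Prop_irrelevance e erefl) /= => Zv'; exact: sCA.
by move=> /(_ U nU)[N DN NU]; exists N.
Qed.

Lemma evt_dense_vprod (k : nat) (n : 'I_k -> nat) (Sv : forall l, set 'cV[R]_(n l))
    (u : forall l, nat -> 'cV[R]_(n l)) :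
  (forall l i, Sv l (u l i)) ->
  (forall l x U, Sv l x -> nbhs x U -> exists i, U (u l i)) ->
  evt_dense (vset Sv) (fun N (f : {ffun 'I_k -> 'I_N}) => ((fun l => u l (f l)) : vprod R n)).
Proof.
move=> uS du; split=> [N f l|v U Sv_v nU]; first exact: uS.
have [M nM MU] := nbhs_vprod nU.
have /choice[f Mf] : forall l, exists i, M l (u l i) by move=> l; exact: du (Sv_v l) (nM l).
exists (\max_l f l).+1 => // N /= fN.
have fl l : (f l < N)%N by apply: leq_trans fN; rewrite ltnS (leq_bigmax l).
exists [ffun l => Ordinal (fl l)]; apply: MU => l.
by rewrite ffunE /=; exact: Mf.
Qed.

End dense.

(** * Continuity of the two objectives *)

Section continuity.
Context {R : realType}.

Lemma continuous_bigsum {X : topologicalType} {I : Type} (r : seq I) (F : I -> X -> R) :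
  (forall i, continuous (F i)) -> continuous (fun x => \sum_(i <- r) F i x).
Proof.
move=> cF x; elim: r => [|i r IH].
  rewrite (_ : (fun _ => _) = cst 0); first exact: cst_continuous.
  by apply/funext => y; rewrite big_nil.
rewrite (_ : (fun _ => _) = fun x => F i x + \sum_(i <- r) F i x).
  by apply: continuousD; [exact: cF|exact: IH].
by apply/funext => y; rewrite big_cons.
Qed.

Lemma continuous_affine {X : topologicalType} {m : nat} (M : 'M[R]_m) (c : 'cV[R]_m)
    (f : X -> 'cV[R]_m) (j : 'I_m) :
  (forall i, continuous (fun x => f x i 0)) ->
  continuous (fun x => affine M c (f x) j 0).
Proof.
move=> cf.
rewrite (_ : (fun _ => _) = fun x => \sum_i M j i * f x i 0 + c j 0); last first.
  by apply/funext => x; rewrite !mxE.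
move=> x; apply: continuousD; last exact: cst_continuous.
apply: continuous_bigsum => i y; apply: continuousM; first exact: cst_continuous.
exact: cf.
Qed.

Lemma continuous_norm2 {X : topologicalType} {m : nat} (f : X -> 'cV[R]_m) :
  (forall i, continuous (fun x => f x i 0)) -> continuous (fun x => norm2 (f x)).
Proof.
move=> cf x; apply: (@continuous_comp _ _ _ (fun x => \sum_i f x i 0 ^+ 2) Num.sqrt).
  apply: continuous_bigsum => i y.
  by apply: (@continuous_comp _ _ _ (fun x => f x i 0) (fun r => r ^+ 2)); [exact: cf|exact: exprn_continuous].
exact: sqrt_continuous.
Qed.

Context {k d : nat} {n : 'I_k -> nat}.
Variables (A : 'I_k -> 'M[R]_d) (a : 'I_k -> 'cV[R]_d)
  (B : forall l : 'I_k, 'M[R]_(n l)) (b : forall l : 'I_k, 'cV[R]_(n l)).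
Local Notation WV := ('cV[R]_d * vprod R n)%type.

Let continuous_al l (j : 'I_d) : continuous (fun p : WV => affine (A l) (a l) p.1 j 0).
Proof.
apply: continuous_affine => i p.
apply: (@continuous_comp _ _ _ fst (fun w : 'cV[R]_d => w i 0)).
  exact: cvg_fst.
exact: coord_continuous.
Qed.

Let continuous_be l (i : 'I_(n l)) : continuous (fun p : WV => affine (B l) (b l) (p.2 l) i 0).
Proof.
apply: (@continuous_affine _ _ _ _ (fun p : WV => p.2 l)) => j p.
apply: (@continuous_comp _ _ _ (fun p : WV => p.2 l) (fun w : 'cV[R]_(n l) => w j 0)).
  apply: (@continuous_comp _ _ _ snd (fun v : vprod R n => v l)).
    exact: cvg_snd.
  exact: (@proj_continuous _ (fun l : 'I_k => 'cV[R]_(n l)) l).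
exact: coord_continuous.
Qed.

Lemma continuous_Phi_coef u : continuous (fun p : WV => Phi_coef A a B b p.1 p.2 u).
Proof.
case: u => l [[[i j]|j]|i] p /=; try exact: cst_continuous.
by apply: continuousM; [exact: continuous_be|exact: continuous_al].
Qed.

Lemma continuous_phi_coef u : continuous (fun p : WV => phi_coef A a B b p.1 p.2 u).
Proof.
case: u => l [[[i j]|j]|i] p /=; first exact: cst_continuous.
- apply: (@continuousM _ _ (fun p : WV => norm2 (affine (B l) (b l) (p.2 l)))
    (fun p : WV => affine (A l) (a l) p.1 j 0)); last exact: continuous_al.
  by apply: continuous_norm2 => i; exact: continuous_be.
- apply: (@continuousM _ _ (fun p : WV => norm2 (affine (A l) (a l) p.1))
    (fun p : WV => affine (B l) (b l) (p.2 l) i 0)); last exact: continuous_be.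
  by apply: continuous_norm2 => j; exact: continuous_al.
Qed.

Lemma within_continuous_lin_comb (D : set WV) (U : finType) (psi : 'cV[R]_d -> vprod R n -> R)
    (x : U -> R) (coef : 'cV[R]_d -> vprod R n -> U -> R) :
  {within D, continuous (fun p : WV => psi p.1 p.2)} ->
  (forall u, continuous (fun p : WV => coef p.1 p.2 u)) ->
  {within D, continuous (fun p : WV => \sum_u x u * coef p.1 p.2 u + psi p.1 p.2)}.
Proof.
move=> cpsi cc p; apply: continuousD; last exact: cpsi.
apply: continuous_subspaceT; apply: continuous_bigsum => u q.
by apply: continuousM; [exact: cst_continuous|exact: cc].
Qed.

End continuity.

(** * Events, values of min-max problems, convex combinations *)

Section assembly_lemmas.
Context {dT : measure_display} {T : measurableType dT} {R : realType}.
Variable P : probability T R.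

Lemma wp_atleast_and (x y : R) (Q Q' : T -> Prop) :
  wp_atleast P (1 - x) Q -> wp_atleast P (1 - y) Q' ->
  wp_atleast P (1 - (x + y)) (fun t => Q t /\ Q' t).
Proof.
move=> [E [mE [PE EQ]]] [E' [mE' [PE' EQ']]].
exists (E `&` E'); split; first exact: measurableI.
split; last by move=> t [Et E't]; split; [exact: EQ|exact: EQ'].
have Pfin (Y : set T) : measurable Y -> P Y = (fine (P Y))%:E.
  by move=> mY; rewrite fineK// fin_num_measure.
have mEE := measurableI _ _ mE mE'.
have : (P (~` E `|` ~` E') <= P (~` E) + P (~` E'))%E.
  by apply: measureU2; exact: measurableC.
rewrite -setCI !probability_setC//.
move: PE PE'; rewrite (Pfin _ mE) (Pfin _ mE') (Pfin _ mEE) -!EFinB -EFinD !lee_fin.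
lra.
Qed.

Lemma wp_atleast_trivial (x : R) (Q : T -> Prop) : x <= 0 -> wp_atleast P x Q.
Proof. by move=> x0; exists set0; split => //; split => //; rewrite measure0 lee_fin. Qed.

Lemma wp_atleast_all (x : R) (Q : T -> Prop) : x <= 1 -> (forall t, Q t) -> wp_atleast P x Q.
Proof.
by move=> x1 QT; exists setT; split => //; split => //; rewrite probability_setT lee_fin.
Qed.

Lemma wp_atleast_mono (x : R) (Q Q' : T -> Prop) : (forall t, Q t -> Q' t) ->
  wp_atleast P x Q -> wp_atleast P x Q'.
Proof. by move=> QQ' [E [mE [PE EQ]]]; exists E; do 2 split => //; move=> t /EQ /QQ'. Qed.

Lemma minmax_lt {W V : Type} (X : set W) (Y : set V) (f : W -> V -> R) (c : R) :
  (minmax X Y f < c%:E)%E -> exists2 w, X w & forall v, Y v -> f w v < c.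
Proof.
move=> /ereal_inf_lt[_ [w Xw <-] fw]; exists w => // v Yv.
rewrite -lte_fin; apply: le_lt_trans fw; apply: ereal_sup_ubound.
by exists v.
Qed.

Lemma minmax_gt {W V : Type} (X : set W) (Y : set V) (f : W -> V -> R) (c : R) :
  (c%:E < minmax X Y f)%E -> forall w, X w -> exists2 v, Y v & c < f w v.
Proof.
move=> fc w Xw.
have : (c%:E < ereal_sup [set (f w v)%:E | v in Y])%E.
  by apply: (lt_le_trans fc); apply: ereal_inf_lbound; exists w.
by move=> /ereal_sup_gt[_ [v Yv <-]]; rewrite lte_fin => fv; exists v.
Qed.

Lemma within_continuous_swap {W V : topologicalType} (X : set W) (Y : set V)
    (f : W -> V -> R) :
  {within X `*` Y, continuous (fun p : W * V => f p.1 p.2)} ->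
  {within Y `*` X, continuous (fun p : V * W => f p.2 p.1)}.
Proof.
move=> /subspace_continuousP cf; apply/subspace_continuousP => -[y x] [/= Yy Xx] N /= nN.
have [[U U'] [/= nU nU'] UU] := cf (x, y) (conj Xx Yy) N nN.
exists (U', U) => //= -[y' x'] [/= Uy' Ux'] [/= Yy' Xx'].
exact: (UU (x', y')).
Qed.

Lemma within_continuous_swapN {W V : topologicalType} (X : set W) (Y : set V)
    (f : W -> V -> R) :
  {within X `*` Y, continuous (fun p : W * V => f p.1 p.2)} ->
  {within Y `*` X, continuous (fun p : V * W => - f p.2 p.1)}.
Proof. by move=> /within_continuous_swap cf p; apply: continuousN; exact: cf. Qed.

Definition mixc {m : nat} (t : R) (x y : 'cV[R]_m) : 'cV[R]_m := t *: x + (1 - t) *: y.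

Lemma convex_set_mixc {m : nat} (X : set 'cV[R]_m) : convex_set X -> mix_closed mixc X.
Proof.
move=> cX t x y /andP[t0 t1] Xx Xy.
have := cX x y (Itv01 t0 t1); rewrite !inE; exact.
Qed.

Lemma convex_function_mixc {m : nat} (X : set 'cV[R]_m) (f : 'cV[R]_m -> R) :
  convex_function X f -> mix_convex mixc X f.
Proof.
move=> cf t x y /andP[t0 t1] Xx Xy.
have := cf (Itv01 t0 t1) x y; rewrite !inE; exact.
Qed.

Lemma dotv_mixr {m : nat} (z x y : 'cV[R]_m) t :
  dotv z (mixc t x y) = t * dotv z x + (1 - t) * dotv z y.
Proof. by rewrite /dotv /mixc mulmxDr -!scalemxAr !mxE. Qed.

Lemma dotv_mixl {m : nat} (z x y : 'cV[R]_m) t :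
  dotv (mixc t x y) z = t * dotv x z + (1 - t) * dotv y z.
Proof. by rewrite /dotv /mixc linearD !linearZ mulmxDl -!scalemxAl !mxE. Qed.

Lemma mulmx_mixc {m p : nat} (M : 'M[R]_(p, m)) (x y : 'cV[R]_m) t :
  M *m mixc t x y = mixc t (M *m x) (M *m y).
Proof. by rewrite /mixc mulmxDr -!scalemxAr. Qed.

Lemma affine_mixc {m : nat} (M : 'M[R]_m) (c x y : 'cV[R]_m) t :
  affine M c (mixc t x y) = mixc t (affine M c x) (affine M c y).
Proof.
rewrite /affine mulmx_mixc /mixc !scalerDr addrACA -scalerDl subrKC.
by rewrite scale1r.
Qed.

End assembly_lemmas.

(** * The two one-sided bounds combined *)

Theorem theorem4p2 (R : realType) (dT : measure_display) (T : measurableType dT)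
  (P : probability T R)
  (k d : nat) (n : 'I_k -> nat) (hk : (0 < k)%N)
  (Sw : set 'cV[R]_d) (Sv : forall l : 'I_k, set 'cV[R]_(n l))
  (psi : 'cV[R]_d -> vprod R n -> R)
  (A : 'I_k -> 'M[R]_d) (a : 'I_k -> 'cV[R]_d)
  (B : forall l : 'I_k, 'M[R]_(n l)) (b : forall l : 'I_k, 'cV[R]_(n l))
  (G : forall l : 'I_k, T -> 'M[R]_(n l, d)) (g : 'I_k -> T -> 'cV[R]_d)
  (h : forall l : 'I_k, T -> 'cV[R]_(n l))
  (S : set 'cV[R]_d) (eps delta phibar phibarSc : R) :
  compact Sw -> convex_set Sw ->
  (forall l, compact (Sv l)) -> (forall l, convex_set (Sv l)) ->
  {within Sw `*` vset Sv,
    continuous (fun p : 'cV[R]_d * vprod R n => psi p.1 p.2)} ->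
  convex_in_w Sw (vset Sv) psi ->
  concave_in_v Sw (vset Sv) psi ->
  iid_std_normal P (gentries G g h) ->
  rel_open Sw S ->
  0 < eps -> 0 < delta ->
  phibar + 3 * delta <= phibarSc ->
  wp_atleast P (1 - eps) (fun t =>
    (minmax Sw (vset Sv) (phiObj A a B b psi (fun l => g l t) (fun l => h l t))
       < (phibar + delta)%:E)%E) ->
  wp_atleast P (1 - eps) (fun t =>
    ((phibarSc - delta)%:E
       < minmax (Sw `\` S) (vset Sv) (phiObj A a B b psi (fun l => g l t) (fun l => h l t)))%E) ->
  wp_atleast P (1 - 2 ^+ k.+1 * eps) (fun t =>
    forall w, Sw w ->
      (forall w', Sw w' ->
         (maxv (vset Sv) (PhiObj A a B b psi (fun l => G l t)) w
          <= maxv (vset Sv) (PhiObj A a B b psi (fun l => G l t)) w')%E) ->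
      S w).
Proof.
move=> cSw cvSw cSv cvSv cpsi psiw psiv iid [SSw [U [oU SU]]] eps0 delta0 gap hSw hSc.
have C0 : (0 : R) <= 2 ^+ k by rewrite exprn_ge0.
have [[w0 [Sw0 nS0]]|noSc] := pselect (exists w, Sw w /\ ~ S w); last first.
  apply: wp_atleast_all => [|t w Sww _]; first by rewrite gerBl mulr_ge0 ?exprn_ge0// ltW.
  by apply: contrapT => nS; apply: noSc; exists w.
(* With no v, the inner suprema are -oo, so the event in [hSc] is empty; then eps >= 1 and the
   claimed probability is at most 0. *)
have [[v0 Svv0]|noV] := pselect (exists v, vset Sv v); last first.
  apply: wp_atleast_trivial.
  have [E [mE [PE HE]]] := hSc.
  have E0 : E = set0.
    rewrite -subset0 => t /HE /minmax_gt /(_ w0 (conj Sw0 nS0)) [v Svv _].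
    by apply: noV; exists v.
  move: PE; rewrite E0 measure0 lee_fin subr_le0 => eps1.
  rewrite subr_le0; apply: (le_trans eps1).
  by apply: ler_peMl; [exact: ltW|apply: exprn_ege1; rewrite ler1n].
have cSc : compact (Sw `\` S).
  rewrite (_ : _ `\` _ = Sw `&` ~` U).
    by apply: compact_closedI => //; exact: open_closedC.
  by rewrite SU; apply/seteqP; split => w /= [Sww nU]; split => //; [move=> Uw; apply: nU|case].
have cV : compact (vset Sv) by exact: tychonoff.
have mX u : measurable_fun setT (gentries G g h u) by case: iid.
have mlin (coef : 'cV[R]_d -> vprod R n -> gidx d n -> R) w v :
    measurable_fun setT (fun t => \sum_u gentries G g h u t * coef w v u + psi w v).
  by apply: measurable_funD => //; apply: measurable_sum => u; exact: measurable_funM.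
pose Phi t := PhiObj A a B b psi (fun l => G l t).
pose phi t := phiObj A a B b psi (fun l => g l t) (fun l => h l t).
have PhiE t w v : Phi t w v = \sum_u gentries G g h u t * Phi_coef A a B b w v u + psi w v.
  exact: PhiObj_coef.
have phiE t w v : phi t w v = \sum_u gentries G g h u t * phi_coef A a B b w v u + psi w v.
  exact: phiObj_coef.
have mPhi w v : measurable_fun setT (fun t => Phi t w v).
  by under eq_fun do rewrite PhiE; exact: mlin.
have mphi w v : measurable_fun setT (fun t => phi t w v).
  by under eq_fun do rewrite phiE; exact: mlin.
have ctPhi t : {within Sw `*` vset Sv, continuous (fun p : 'cV[R]_d * vprod R n => Phi t p.1 p.2)}.
  have e : (fun p : 'cV[R]_d * vprod R n => Phi t p.1 p.2) = (fun p =>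
      \sum_u gentries G g h u t * Phi_coef A a B b p.1 p.2 u + psi p.1 p.2).
    by apply/funext => p; exact: PhiE.
  apply: (eq_ind_r (fun f : 'cV[R]_d * vprod R n -> R =>
    {within Sw `*` vset Sv, continuous f}) _ e).
  by apply: within_continuous_lin_comb => // u; exact: continuous_Phi_coef.
have ctphi t : {within Sw `*` vset Sv, continuous (fun p : 'cV[R]_d * vprod R n => phi t p.1 p.2)}.
  have e : (fun p : 'cV[R]_d * vprod R n => phi t p.1 p.2) = (fun p =>
      \sum_u gentries G g h u t * phi_coef A a B b p.1 p.2 u + psi p.1 p.2).
    by apply/funext => p; exact: phiE.
  apply: (eq_ind_r (fun f : 'cV[R]_d * vprod R n -> R =>
    {within Sw `*` vset Sv, continuous f}) _ e).
  by apply: within_continuous_lin_comb => // u; exact: continuous_phi_coef.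
have subSc : (Sw `\` S) `*` vset Sv `<=` Sw `*` vset Sv by move=> [w v] [[/= ? _] ?].
have [uw [uwS uwd]] := @compact_dense_seq R 'cV[R]_d _ cSw (ex_intro _ w0 Sw0).
have [uc [ucS ucd]] := @compact_dense_seq R 'cV[R]_d _ cSc (ex_intro _ w0 (conj Sw0 nS0)).
pose uv l := sval (cid (@compact_dense_seq R 'cV[R]_(n l) _ (cSv l) (ex_intro _ (v0 l) (Svv0 l)))).
have uvP l := svalP (cid (@compact_dense_seq R 'cV[R]_(n l) _ (cSv l) (ex_intro _ (v0 l) (Svv0 l)))).
have dw := evt_dense_seq uwS uwd.
have dc := evt_dense_seq ucS ucd.
have dv := evt_dense_vprod (fun l => (uvP l).1) (fun l => (uvP l).2).
(* With eighths, Phi off [S] reaches at least phibarSc - 5 delta/4 >= phibar + 7 delta/4 for some v,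
   while the minimax step below ends at phibar + 3 delta/2. *)
have rho0 : 0 < delta / 8 by rewrite divr_gt0.
have E1 := @minmax_transfer _ _ _ P _ _ (Sw `\` S) (vset Sv) Phi phi _ _ _ _ (2 ^+ k)
  (phibarSc - delta - delta / 8) (delta / 8) eps cSc cV dc dv
  (fun t => continuous_subspaceW subSc (ctPhi t))
  (fun t => continuous_subspaceW subSc (ctphi t)) mPhi mphi C0 rho0.
have {}E1 : wp_atleast P (1 - 2 ^+ k * eps) (fun t => forall w, (Sw `\` S) w ->
    exists2 v, vset Sv v & phibarSc - delta - delta / 8 - delta / 8 <= Phi t w v).
  apply: E1.
    move=> N mu m; apply: integral_testfun_Phi_le => // c c' cc'.
    by left; rewrite cc'.
  by apply: wp_atleast_mono hSc => t; rewrite subrK; exact: minmax_gt.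
(* Rows are now indexed by v and columns by w: a lower bound on max_w of -Phi for every v bounds
   max_v min_w of Phi from above. *)
have E2 := @minmax_transfer _ _ _ P _ _ (vset Sv) Sw (fun t v w => - Phi t w v)
  (fun t v w => - phi t w v) _ _ _ _ (2 ^+ k)
  (- (phibar + delta) - delta / 8) (delta / 8) eps cV cSw dv dw
  _ _ (fun v w => measurable_funN (mPhi w v)) (fun v w => measurable_funN (mphi w v)) C0 rho0.
have {}E2 : wp_atleast P (1 - 2 ^+ k * eps) (fun t => forall v, vset Sv v ->
    exists2 w, Sw w & - (phibar + delta) - delta / 8 - delta / 8 <= - Phi t w v).
  apply: E2.
  - by move=> t; exact: (within_continuous_swapN (ctPhi t)).
  - by move=> t; exact: (within_continuous_swapN (ctphi t)).
  - move=> N mu m.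
    (* The sign moves into the scale, which the comparison allows to be negative. *)
    have sw (f : T -> 'cV[R]_d -> vprod R n -> R) t :
        [ffun e : {ffun 'I_k -> 'I_N} * 'I_N =>
          mu * - f t (uw e.2) (fun l => uv l (e.1 l)) + m e] =
        [ffun e : {ffun 'I_k -> 'I_N} * 'I_N =>
          - mu * f t (uw e.2) (fun l => uv l (e.1 l)) + m e].
      by apply/ffunP => e; rewrite !ffunE mulrN mulNr.
    under eq_integral do rewrite sw.
    under [X in (_ <= _ * X)%E]eq_integral do rewrite sw.
    apply: integral_testfun_Phi_le => // c c' cc'.
    by right; rewrite cc'.
  - apply: wp_atleast_mono hSw => t; rewrite subrK => /minmax_lt[w Sww Hw] v Svv.
    by exists w => //; rewrite ltrN2; exact: Hw.
rewrite (_ : 2 ^+ k.+1 * eps = 2 ^+ k * eps + 2 ^+ k * eps); last by rewrite exprS; ring.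
apply: wp_atleast_mono (wp_atleast_and E1 E2) => t [H1 H2] w Sww minw.
apply: contrapT => nSw; have [v Svv Hv] := H1 w (conj Sww nSw).
(* So far each v has its own w with Phi at most phibar + delta + delta/4. The bilinear part is
   affine in each variable, so [Phi t] is convex-concave, and the minimax theorem gives one w' for
   all v at a further cost of delta/4. *)
have [w' Sww' Hw'] : exists2 w', Sw w' & forall v, vset Sv v -> Phi t w' v <= phibar + delta + delta / 2.
  apply: (@compact_minimax R _ _ mixc (fun t v v' l => mixc t (v l) (v' l)) Sw (vset Sv)
    (Phi t) _ (phibar + delta + delta / 4)) => //.
  - exact: convex_set_mixc.
  - by move=> s x y s01 Sx Sy l; apply: convex_set_mixc.
  - move=> v' Sv' s x y s01 Sx Sy; rewrite /Phi /PhiObj.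
    have := convex_function_mixc (psiw v' Sv') s01 Sx Sy.
    have -> : \sum_(l < k) dotv (affine (B l) (b l) (v' l)) (G l t *m affine (A l) (a l) (mixc s x y)) =
       s * (\sum_(l < k) dotv (affine (B l) (b l) (v' l)) (G l t *m affine (A l) (a l) x)) +
       (1 - s) * (\sum_(l < k) dotv (affine (B l) (b l) (v' l)) (G l t *m affine (A l) (a l) y)).
      rewrite !mulr_sumr -big_split/=; apply: eq_bigr => l _.
      by rewrite affine_mixc mulmx_mixc dotv_mixr.
    by lra.
  - move=> x Sx s y y' s01 Sy Sy'; rewrite /Phi /PhiObj.
    have := psiv x Sx y y' Sy Sy' s s01.
    have -> : \sum_(l < k) dotv (affine (B l) (b l) (mixc s (y l) (y' l))) (G l t *m affine (A l) (a l) x) =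
       s * (\sum_(l < k) dotv (affine (B l) (b l) (y l)) (G l t *m affine (A l) (a l) x)) +
       (1 - s) * (\sum_(l < k) dotv (affine (B l) (b l) (y' l)) (G l t *m affine (A l) (a l) x)).
      rewrite !mulr_sumr -big_split/=; apply: eq_bigr => l _.
      by rewrite affine_mixc dotv_mixl.
    by rewrite /mixc; lra.
  - exact: near_lt_within_fst (ctPhi t).
  - by lra.
  - by exists v0.
  - by move=> v' /H2[x Sx Hx]; exists x => //; lra.
have := minw w' Sww'.
suff : (maxv (vset Sv) (Phi t) w' < maxv (vset Sv) (Phi t) w)%E by rewrite ltNge => /negP.
apply: (@le_lt_trans _ _ (phibar + delta + delta / 2)%:E).
  by apply: ge_ereal_sup => _ [v' Sv' <-]; rewrite lee_fin Hw'.
apply: (@lt_le_trans _ _ (Phi t w v)%:E); first by rewrite lte_fin; lra.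
by apply: ereal_sup_ubound; exists v.
Qed.
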